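(* Let $\mathfrak{g}$ be a notion of guarding, either atom guarding or loose guarding, let $\sigma$ be a relational vocabulary and let $n,k$ be positive integers. For any $\mathfrak{g}$-guarded sentence $\varphi$ in $n$ variables of guarded-quantifier rank at most $k$, the following are equivalent: (1) $\varphi$ is preserved under homomorphisms of $\sigma$-structures; (2) $\varphi$ is logically equivalent to an existential positive $\mathfrak{g}$-guarded sentence in $n$ variables of guarded-quantifier rank at most $k$.
   Context: A relational vocabulary has no function or constant symbols; equality is allowed. Guarded formulas are built from atomic formulas by Boolean connectives and guarded quantification: if $\phi(\bar x,\bar y)$ is guarded then so are $\exists\bar x.\,(G(\bar x,\bar y)\wedge\phi(\bar x,\bar y))$ and $\forall\bar x.\,(G(\bar x,\bar y)\to\phi(\bar x,\bar y))$, where $G$ is a guard. For atom guarding, $G(\bar x,\bar y)$ is an atomic formula in which all variables of $\bar x,\bar y$ occur; for loose guarding, $G(\bar x,\bar y)$ is a conjunction of atomic formulas such that each pair of variables, one from $\bar x$ and the other from $\bar x,\bar y$, occurs together in some conjunct. A sentence is in $n$ variables if it uses at most $n$ distinct variables; its guarded-quantifier rank is the maximum nesting depth of guarded quantifiers (each guarded quantifier block over a tuple counting once). The existential positive guarded fragment consists of guarded sentences built using only $\vee,\wedge$ and guarded existential quantification. A sentence is preserved under homomorphisms if whenever $\mathcal{A}\models\varphi$ and there is a homomorphism $\mathcal{A}\to\mathcal{B}$, then $\mathcal{B}\models\varphi$. *)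

(* Defs.v *)
From mathcomp Require Import all_boot.

Set Implicit Arguments.
Unset Strict Implicit.
Unset Printing Implicit Defensive.

Record vocabulary := Vocabulary { symbol : Type; arity : symbol -> nat }.

(* The universe may be empty; see [assignment]. *)
Record structure (sigma : vocabulary) := Structure {
  carrier :> Type;
  interp : forall R : symbol sigma, (arity R).-tuple carrier -> Prop }.

Definition is_hom (sigma : vocabulary) (A B : structure sigma) (h : A -> B) :=
  forall (R : symbol sigma) (a : (arity R).-tuple A),
    interp a -> interp (map_tuple h a).

Section Syntax.
Variable sigma : vocabulary.

(* Variables are natural numbers. *)
Inductive atom :=
  | Rel (R : symbol sigma) (xs : (arity R).-tuple nat)
  | Eq (x y : nat).

(* [GEx xs G phi] is  exists xs, (/\ G) /\ phi  and [GAll xs G phi] is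
   forall xs, (/\ G) -> phi  where [/\ G] is the conjunction of the list [G];
   an atom guard is a list of length one. The admissibility of [G] as a guard
   is the predicate [is_guard] below. [Top] and [Bot] are the empty
   conjunction and the empty disjunction. *)
Inductive formula :=
  | Atom of atom
  | Top
  | Bot
  | Not of formula
  | And of formula & formula
  | Or of formula & formula
  | GEx (xs : seq nat) (G : seq atom) (phi : formula)
  | GAll (xs : seq nat) (G : seq atom) (phi : formula).

Definition atom_vars (a : atom) : seq nat :=
  match a with Rel _ xs => xs | Eq x y => [:: x; y] end.

Definition guard_vars (G : seq atom) : seq nat := flatten (map atom_vars G).

Fixpoint free_vars (phi : formula) : seq nat :=
  match phi with
  | Atom a => atom_vars a
  | Top | Bot => [::]
  | Not p => free_vars p
  | And p q | Or p q => free_vars p ++ free_vars q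
  | GEx xs G p | GAll xs G p =>
      [seq y <- guard_vars G ++ free_vars p | y \notin xs]
  end.

Definition is_sentence (phi : formula) : bool := nilp (free_vars phi).

Fixpoint all_vars (phi : formula) : seq nat :=
  match phi with
  | Atom a => atom_vars a
  | Top | Bot => [::]
  | Not p => all_vars p
  | And p q | Or p q => all_vars p ++ all_vars q
  | GEx xs G p | GAll xs G p => xs ++ guard_vars G ++ all_vars p
  end.

Definition num_vars (phi : formula) : nat := size (undup (all_vars phi)).

Fixpoint rank (phi : formula) : nat :=
  match phi with
  | Atom _ | Top | Bot => 0
  | Not p => rank p
  | And p q | Or p q => maxn (rank p) (rank q)
  | GEx _ _ p | GAll _ _ p => (rank p).+1
  end.

Inductive guarding := AtomGuarding | LooseGuarding.

(* In  Q xs. G(xs, ys) . phi(xs, ys)  the tuple ys is not recorded in the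
   syntax: it lists the variables outside xs that are free in G or in phi. In
   the loose case u and v may coincide, so that every quantified variable
   occurs in G. *)
Definition is_guard (g : guarding) (xs : seq nat) (G : seq atom)
    (phi : formula) : bool :=
  let scope := xs ++ guard_vars G ++ free_vars phi in
  match g with
  | AtomGuarding =>
      if G is [:: a] then all [in atom_vars a] scope else false
  | LooseGuarding =>
      all (fun u => all (fun v =>
        has (fun a => (u \in atom_vars a) && (v \in atom_vars a)) G) scope) xs
  end.

Fixpoint guarded (g : guarding) (phi : formula) : bool :=
  match phi with
  | Atom _ | Top | Bot => true
  | Not p => guarded g p
  | And p q | Or p q => guarded g p && guarded g q
  | GEx xs G p | GAll xs G p => is_guard g xs G p && guarded g p
  end.

Fixpoint existential_positive (phi : formula) : bool :=
  match phi with
  | Atom _ | Top | Bot => true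
  | And p q | Or p q => existential_positive p && existential_positive q
  | GEx _ _ p => existential_positive p
  | Not _ | GAll _ _ _ => false
  end.

End Syntax.

Arguments Top {sigma}.
Arguments Bot {sigma}.
Arguments Eq {sigma} x y.

Section Semantics.
Variables (sigma : vocabulary) (A : structure sigma).

(* Assignments are partial, so that sentences can be evaluated, under the
   nowhere defined assignment, in structures with empty universe. *)
Definition assignment := nat -> option A.

Definition reassigns (xs : seq nat) (e e' : assignment) : Prop :=
  forall x, if x \in xs then isSome (e' x) : Prop else e' x = e x.

Definition sat_atom (e : assignment) (a : atom sigma) : Prop :=
  match a with
  | Rel R xs =>
      exists2 v : (arity R).-tuple A, map e xs = map Some v & interp v
  | Eq x y => exists2 v : A, e x = Some v & e y = Some v
  end.

Definition sat_guard (e : assignment) (G : seq (atom sigma)) : Prop :=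
  foldr (fun a P => sat_atom e a /\ P) True G.

Fixpoint sat (e : assignment) (phi : formula sigma) : Prop :=
  match phi with
  | Atom a => sat_atom e a
  | Top => True
  | Bot => False
  | Not p => ~ sat e p
  | And p q => sat e p /\ sat e q
  | Or p q => sat e p \/ sat e q
  | GEx xs G p =>
      exists e', reassigns xs e e' /\ sat_guard e' G /\ sat e' p
  | GAll xs G p =>
      forall e', reassigns xs e e' -> sat_guard e' G -> sat e' p
  end.

Definition models (phi : formula sigma) : Prop := sat (fun=> None) phi.

End Semantics.

Definition preserved_under_homs (sigma : vocabulary) (phi : formula sigma) :=
  forall (A B : structure sigma) (h : A -> B),
    is_hom h -> models A phi -> models B phi.

Definition logically_equivalent (sigma : vocabulary) (phi psi : formula sigma) :=
  forall A : structure sigma, models A phi <-> models A psi.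

(* Main.v *)
(* Write A => B when every primitive positive guarded sentence in the given
   variables, relation symbols and rank that holds in A holds in B. Up to
   equivalence there are finitely many such sentences, so it suffices to show
   that a sentence preserved under homomorphisms passes from A to B whenever
   A => B. It does so along

      A  ~  T(A)  ->  T'(A)  ~  T'(B)  ->  B

   where -> is a homomorphism and ~ agreement on the sentences considered. Here
   T(A) is the guarded tree unravelling of A, and T'(A), T'(B) are unravellings
   in which each bag carries a tuple of A (of B) together with a smaller
   primitive positive type, realised anywhere, and starting from the type of A
   over the empty tuple in both cases. Such bags are so plentiful that
   Duplicator can always reproduce the type of Spoiler's tuple up to the
   remaining rank: a suitable type over the current one is that of a tuple in
   a product of an amalgam. *)
Require Import Defs.
From mathcomp Require Import all_boot boolp.
From Stdlib Require List.

Set Implicit Arguments.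
Unset Strict Implicit.
Unset Printing Implicit Defensive.

(** * Syntax and evaluation *)

(** The hypothesis A => B runs one way, whereas a guarded sentence with negations is transported by
    a game with moves from both sides. The game is therefore played on types alone: the elements of
    A and of B carried by the bags are never compared with each other. Those of B serve to map T'(B)
    into B, and what is asked of them, that they satisfy the formulas of the type, is as one-sided
    as A => B. Letting a type be realised in any structure takes the place of a saturated extension
    of B. It also keeps the rank at k: a type of rank i with finitely many variables is one
    conjunction of rank i, and quantifying it costs exactly one. Trees are needed because the images
    of bags can be chosen independently as long as they agree along edges; in A itself overlapping
    tuples may form cycles. All the unravellings are instances of one construction over a [frame],
    in which the truth of a guarded sentence is decided by moves between linked worlds. *)

Definition prestr (T : Type) (D : seq nat) (e : nat -> option T) :
  nat -> option T := fun x => if x \in D then e x else None.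

Notation "e \op r" := (pcomp e r) (at level 50, left associativity).

Lemma pcompA (T : Type) (e : nat -> option T) (r s : nat -> option nat) :
  e \op (r \op s) = (e \op r) \op s.
Proof. by apply/funext => x; rewrite /pcomp /=; case: (s x). Qed.

Lemma pcompSome (T : Type) (e : nat -> option T) : e \op Some = e.
Proof. by []. Qed.

Lemma pcomp_restr (T : Type) (e : nat -> option T) D (r : nat -> option nat) :
  e \op prestr D r = prestr D (e \op r).
Proof. by apply/funext => x; rewrite /pcomp /prestr; case: ifP. Qed.

Lemma prestr_in (T : Type) (e : nat -> option T) D x :
  x \in D -> prestr D e x = e x.
Proof. by rewrite /prestr => ->. Qed.

Lemma prestr_sub (T : Type) (e : nat -> option T) (D D' : seq nat) :
  {subset D <= D'} -> prestr D (prestr D' e) = prestr D e.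
Proof.
move=> sDD'; apply/funext => x; rewrite /prestr.
by case: ifP => // /sDD' ->.
Qed.

Lemma eq_prestr (T : Type) (e e' : nat -> option T) (D : seq nat) :
  {in D, e =1 e'} -> prestr D e = prestr D e'.
Proof.
by move=> ee'; apply/funext => x; rewrite /prestr; case: ifP => // /ee'.
Qed.

Lemma map_Some_def (T : Type) (e : nat -> option T) xs (v : seq T) x :
  map e xs = map Some v -> x \in xs -> isSome (e x).
Proof.
elim: xs v => [|y xs IH] [|z v] //= [ey /IH exs].
by rewrite inE => /orP[/eqP->|/exs //]; rewrite ey.
Qed.

Section Syntax.
Variable sigma : vocabulary.
Implicit Types (phi p q : formula sigma) (G : seq (atom sigma)).

Lemma guard_varsP G x :
  reflect (exists2 a, List.In a G & x \in atom_vars a) (x \in guard_vars G).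
Proof.
elim: G => [|b G IH] /=; first by constructor; case.
rewrite /guard_vars /= mem_cat; apply: (iffP orP) => [[xb|/IH[a aG xa]]|].
- by exists b => //; left.
- by exists a => //; right.
- by case=> a [->|aG] xa; [left|right; apply/IH; exists a].
Qed.

Lemma has_atomP (P : pred (atom sigma)) G :
  has P G <-> exists2 a, List.In a G & P a.
Proof.
elim: G => [|b G IH] /=; first by split=> // -[].
split=> [/orP[Pb|/IH[a aG Pa]]|[a [->->//|aG] Pa]].
- by exists b => //; left.
- by exists a => //; right.
- by apply/orP; right; apply/IH; exists a.
Qed.

Definition scope xs G phi := xs ++ guard_vars G ++ free_vars phi.

Lemma mem_free_vars_ex xs G p x :
  (x \in free_vars (GEx xs G p)) =
  (x \notin xs) && ((x \in guard_vars G) || (x \in free_vars p)).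
Proof. by rewrite mem_filter mem_cat. Qed.

Lemma mem_scope xs G p x :
  (x \in scope xs G p) = (x \in xs) || (x \in free_vars (GEx xs G p)).
Proof.
rewrite mem_free_vars_ex /scope !mem_cat.
by case: (x \in xs) => //=.
Qed.

Lemma scope_free xs G p : {subset free_vars (GEx xs G p) <= scope xs G p}.
Proof. by move=> x xf; rewrite mem_scope xf orbT. Qed.

Lemma scope_guard xs G p : {subset guard_vars G <= scope xs G p}.
Proof. by move=> x xG; rewrite !mem_cat xG orbT. Qed.

Lemma scope_atom xs G p a :
  List.In a G -> {subset atom_vars a <= scope xs G p}.
Proof. by move=> aG x xa; apply: scope_guard; apply/guard_varsP; exists a. Qed.

Lemma scope_body xs G p : {subset free_vars p <= scope xs G p}.
Proof. by move=> x xp; rewrite !mem_cat xp !orbT. Qed.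

(** Semantic arguments use a guard only through this pairwise occurrence, which both notions of
    guarding provide; the two are told apart only when guards are rebuilt. *)
Lemma is_guard_loose g xs G p u v :
  is_guard g xs G p -> u \in xs -> v \in scope xs G p ->
  exists a, [/\ List.In a G, u \in atom_vars a & v \in atom_vars a].
Proof.
case: g => /=.
  case: G => [//|a [|//]] /allP aP uxs vsc; exists a; split; first by left.
    by apply: aP; rewrite mem_cat uxs.
  exact: aP.
move=> /allP/(_ u) H /H /allP{}H /H /has_atomP[a aG /andP[ua va]].
by exists a.
Qed.

Lemma is_guard_quantified g xs G p :
  is_guard g xs G p -> {subset xs <= guard_vars G}.
Proof.
move=> gd x xxs; have xs_x : x \in scope xs G p by rewrite mem_scope xxs.
have [a [aG xa _]] := is_guard_loose gd xxs xs_x.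
by apply/guard_varsP; exists a.
Qed.

Lemma free_vars_sub phi : {subset free_vars phi <= all_vars phi}.
Proof.
elim: phi => //= [a|p IHp q IHq|p IHp q IHq|xs G p IH|xs G p IH] x //.
1,2: by rewrite !mem_cat => /orP[/IHp|/IHq] ->; rewrite ?orbT.
1,2: rewrite mem_filter !mem_cat => /andP[_ /orP[|/IH]] ->.
all: by rewrite ?orbT.
Qed.

Definition atom_symbols (S : seq (symbol sigma)) (a : atom sigma) : Prop :=
  if a is Rel R _ then List.In R S else True.

Fixpoint symbols_in (S : seq (symbol sigma)) phi : Prop :=
  match phi with
  | Atom a => atom_symbols S a
  | Top | Bot => True
  | Not p => symbols_in S p
  | And p q | Or p q => symbols_in S p /\ symbols_in S q
  | GEx _ G p | GAll _ G p =>
      (forall a, List.In a G -> atom_symbols S a) /\ symbols_in S p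
  end.

Lemma atom_symbols_sub S S' a :
  (forall R, List.In R S -> List.In R S') ->
  atom_symbols S a -> atom_symbols S' a.
Proof. by case: a => //= R _; apply. Qed.

Lemma symbols_in_sub S S' phi :
  (forall R, List.In R S -> List.In R S') ->
  symbols_in S phi -> symbols_in S' phi.
Proof.
move=> sSS'; elim: phi => //= [a|p IHp q IHq|p IHp q IHq|xs G p IH|xs G p IH].
- exact: atom_symbols_sub.
- by case=> /IHp ? /IHq.
- by case=> /IHp ? /IHq.
- by case=> GS /IH; split=> // a /GS; apply: atom_symbols_sub.
- by case=> GS /IH; split=> // a /GS; apply: atom_symbols_sub.
Qed.

Lemma ex_atoms_symbols G : exists S, forall a, List.In a G -> atom_symbols S a.
Proof.
elim: G => [|b G [S SG]]; first by exists [::].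
exists (if b is Rel R _ then R :: S else S) => a [<-|/SG].
  by case: b => //= R _; left.
by apply: atom_symbols_sub; case: b => //= R _ R' ?; right.
Qed.

Lemma ex_symbols_in phi : exists S, symbols_in S phi.
Proof.
elim: phi => [[R xs|x y]|||p [S Sp]|p [S Sp] q [S' Sq]|p [S Sp] q [S' Sq]
  |xs G p [S Sp]|xs G p [S Sp]] /=; try by exists [::].
- by exists [:: R]; left.
- by exists S.
1,2: exists (S ++ S'); split.
1,3: apply: symbols_in_sub Sp.
3,4: apply: symbols_in_sub Sq.
1-4: by move=> R RS; apply/List.in_or_app; auto.
all: have [S' SG] := ex_atoms_symbols G; exists (S ++ S'); split.
1,3: move=> a /SG; apply: atom_symbols_sub.
3,4: apply: symbols_in_sub Sp.
all: by move=> R RS; apply/List.in_or_app; auto.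
Qed.

(** Disjunction is left out because a tuple of a product must satisfy exactly the formulas true of
    both its components. It comes back only in the final sentence. *)
Fixpoint primitive_positive phi : bool :=
  match phi with
  | Atom _ | Top => true
  | And p q => primitive_positive p && primitive_positive q
  | GEx _ _ p => primitive_positive p
  | _ => false
  end.

Lemma primitive_positive_existential phi :
  primitive_positive phi -> existential_positive phi.
Proof.
by elim: phi => //= p IHp q IHq /andP[/IHp -> /IHq].
Qed.

End Syntax.

Section Semantics.
Variables (sigma : vocabulary).
Implicit Types (A B : structure sigma) (phi p q : formula sigma).

Lemma sat_guardP A (e : assignment A) G :
  sat_guard e G <-> forall a, List.In a G -> sat_atom e a.
Proof.
elim: G => [|b G IH] /=; first by split.
split=> [[eb /IH eG] a [<-|/eG]//|H]; split; first by apply: H; left.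
by apply/IH => a aG; apply: H; right.
Qed.

Lemma sat_atom_ext A (e e' : assignment A) a :
  {in atom_vars a, e =1 e'} -> sat_atom e a -> sat_atom e' a.
Proof.
case: a => [R xs|x y] /= ee' [v ev Rv]; exists v => //.
- by rewrite -ev; apply/esym/eq_in_map.
- by rewrite -ee' // !inE eqxx.
- by rewrite -ee' // !inE eqxx orbT.
Qed.

Lemma sat_atom_def A (e : assignment A) a x :
  sat_atom e a -> x \in atom_vars a -> isSome (e x).
Proof.
case: a => [R xs|y z] /= [v]; last first.
  by move=> ey ez; rewrite !inE => /orP[]/eqP->; rewrite ?ey ?ez.
by move=> ev _; apply: map_Some_def ev.
Qed.

Lemma sat_guard_def A (e : assignment A) G x :
  sat_guard e G -> x \in guard_vars G -> isSome (e x).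
Proof. by move=> /sat_guardP eG /guard_varsP[a /eG]; apply: sat_atom_def. Qed.

Lemma sat_guard_ext A (e e' : assignment A) G :
  {in guard_vars G, e =1 e'} -> sat_guard e G -> sat_guard e' G.
Proof.
move=> ee' /sat_guardP eG; apply/sat_guardP => a aG.
apply: sat_atom_ext (eG a aG) => x xa.
by apply: ee'; apply/guard_varsP; exists a.
Qed.

Lemma sat_ext A phi (e e' : assignment A) :
  {in free_vars phi, e =1 e'} -> sat e phi <-> sat e' phi.
Proof.
have reas xs (e1 e2 e3 : assignment A) (fv : seq nat) :
    {in [seq y <- fv | y \notin xs], e1 =1 e2} -> reassigns xs e1 e3 ->
    exists2 e4, reassigns xs e2 e4 & {in fv, e3 =1 e4}.
  move=> e12 r13; exists (fun x => if x \in xs then e3 x else e2 x) => x.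
    by have := r13 x; case: ifP.
  have := r13 x; case: ifP => // xxs -> xfv.
  by apply: e12; rewrite mem_filter xxs.
elim: phi e e' => //= [a|p IH|p IHp q IHq|p IHp q IHq|xs G p IH|xs G p IH] e e' ee'.
- by split; apply: sat_atom_ext => // x xa; rewrite ee'.
- by split=> np /IH sp; apply: np; apply: sp => // x xp; rewrite ee'.
1,2: have Ep : {in free_vars p, e =1 e'} by move=> x xp; rewrite ee' // mem_cat xp.
1,2: have Eq : {in free_vars q, e =1 e'}.
1,3: by move=> x xp; rewrite ee' // mem_cat xp orbT.
1,2: by rewrite (IHp _ _ Ep) (IHq _ _ Eq).
- have half (e1 e2 : assignment A) : {in [seq y <- guard_vars G ++ free_vars p | y \notin xs],
      e1 =1 e2} ->
      (exists e3, reassigns xs e1 e3 /\ sat_guard e3 G /\ sat e3 p) ->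
      (exists e3, reassigns xs e2 e3 /\ sat_guard e3 G /\ sat e3 p).
    move=> e12 [e3 [/(reas _ _ _ _ _ e12)[e4 r24 e34] [gG sp]]].
    exists e4; split=> //; split.
      by apply: sat_guard_ext gG => x xG; rewrite e34 // mem_cat xG.
    by apply: (proj1 (IH _ _ _) sp) => x xp; rewrite e34 // mem_cat xp orbT.
  by split; apply: half => // x /ee'.
- have half (e1 e2 : assignment A) : {in [seq y <- guard_vars G ++ free_vars p | y \notin xs],
      e1 =1 e2} ->
      (forall e3, reassigns xs e2 e3 -> sat_guard e3 G -> sat e3 p) ->
      (forall e3, reassigns xs e1 e3 -> sat_guard e3 G -> sat e3 p).
    move=> e12 H e3 r13 gG; have [e4 r24 e34] := reas _ _ _ _ _ e12 r13.
    have e4G : sat_guard e4 G.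
      by apply: sat_guard_ext gG => x xG; rewrite -e34 // mem_cat xG.
    apply: (proj2 (IH _ _ _) (H _ r24 e4G)) => x xp.
    by rewrite e34 // mem_cat xp orbT.
  by split; apply: half => // x /ee'.
Qed.

(** Assignments are partial, and a satisfied conjunctive formula forces its free variables to be
    defined; a disjunction or a negation would not. *)
Lemma pp_sat_def A p (e : assignment A) x :
  primitive_positive p -> sat e p -> x \in free_vars p -> isSome (e x).
Proof.
elim: p e => //= [a|p IHp q IHq|xs G p IH] e.
- by move=> _; apply: sat_atom_def.
- move=> /andP[pp pq] [sp sq]; rewrite mem_cat => /orP[].
    exact: IHp.
  exact: IHq.
- move=> pp [e' [re [eG sp]]]; rewrite mem_filter mem_cat => /andP[xxs].
  have := re x; rewrite (negbTE xxs) => <- /orP[]; first exact: sat_guard_def eG.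
  exact: IH.
Qed.

Lemma sat_atom_hom A B (h : A -> B) (e : assignment A) a :
  is_hom h -> sat_atom e a -> sat_atom (fun x => omap h (e x)) a.
Proof.
move=> hh; case: a => [R xs|x y] /= [v]; last first.
  by move=> -> ->; exists (h v).
move=> ev /hh Rv; exists (map_tuple h v) => //=.
by rewrite (map_comp (omap h) e) ev -!map_comp.
Qed.

Lemma sat_hom A B (h : A -> B) (e : assignment A) p :
  is_hom h -> existential_positive p ->
  sat e p -> sat (fun x => omap h (e x)) p.
Proof.
move=> hh; elim: p e => //= [a|p IHp q IHq|p IHp q IHq|xs G p IH] e.
- by move=> _; apply: sat_atom_hom.
- by move=> /andP[pp pq] [/(IHp _ pp) ? /(IHq _ pq)].
- by move=> /andP[pp pq] [/(IHp _ pp) ?|/(IHq _ pq) ?]; [left|right].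
- move=> pp [e' [re [/sat_guardP eG /(IH _ pp) sp]]].
  exists (fun x => omap h (e' x)); split=> [x|].
    by have := re x; case: ifP => _; [case: (e' x)|move=> ->].
  by split=> //; apply/sat_guardP => a /eG; apply: sat_atom_hom.
Qed.

End Semantics.

(** * Frames and their trees *)

Section Frames.
Variable sigma : vocabulary.

Definition local_atom (E : nat -> nat -> Prop)
    (I : forall R : symbol sigma, (arity R).-tuple nat -> Prop)
    (r : nat -> option nat) (a : atom sigma) : Prop :=
  match a with
  | Rel R xs =>
      exists2 zs : (arity R).-tuple nat, map r xs = map Some zs & I R zs
  | Eq x y => exists a b, [/\ r x = Some a, r y = Some b & E a b]
  end.

(** A number that is not a name counts as undefined, so two values also agree when neither is a
    name. *)
Definition same_value (E : nat -> nat -> Prop) (o o' : option nat) : Prop :=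
  (exists a b, [/\ o = Some a, o' = Some b & E a b]) \/
  (forall a, E a a -> o <> Some a) /\ (forall a, E a a -> o' <> Some a).

(* A world names elements by natural numbers, [feq w x y] saying that [x] and
   [y] name the same element (and [feq w x x] that [x] is a name), and
   [link w r w' r'] that the tuples named by [r] in [w] and by [r'] in [w'] are
   to be identified. *)
Record frame := Frame {
  world : Type;
  feq : world -> nat -> nat -> Prop;
  frel : world -> forall R : symbol sigma, (arity R).-tuple nat -> Prop;
  link : world -> (nat -> option nat) -> world -> (nat -> option nat) -> Prop;
  feq_sym : forall w x y, feq w x y -> feq w y x;
  feq_trans : forall w x y z, feq w x y -> feq w y z -> feq w x z;
  frel_name : forall w R (zs : (arity R).-tuple nat) z,
    frel w zs -> z \in zs -> feq w z z;
  link_same : forall w r r',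
    (forall x, same_value (feq w) (r x) (r' x)) -> link w r w r';
  link_sym : forall w r w' r', link w r w' r' -> link w' r' w r;
  link_trans : forall w r w' r' w'' r'',
    link w r w' r' -> link w' r' w'' r'' -> link w r w'' r'';
  link_comp : forall w r w' r' s,
    link w r w' r' -> link w (r \op s) w' (r' \op s);
  link_atom : forall w r w' r' a, link w r w' r' ->
    local_atom (feq w) (@frel w) r a -> local_atom (feq w') (@frel w') r' a }.

(** Quantifiers range over worlds: a guarded tuple of the tree lies in a single bag, so choosing it
    means choosing a world linked to the current one along the free variables. *)
Fixpoint fsat (F : frame) (w : world F) (r : nat -> option nat)
    (phi : formula sigma) : Prop :=
  match phi with
  | Atom a => local_atom (feq w) (frel w) r a
  | Top => True
  | Bot => False
  | Not p => ~ fsat w r p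
  | And p q => fsat w r p /\ fsat w r q
  | Or p q => fsat w r p \/ fsat w r q
  | GEx xs G p => exists w' r',
      [/\ link w (prestr (free_vars (GEx xs G p)) r)
               w' (prestr (free_vars (GEx xs G p)) r'),
          forall a, List.In a G -> local_atom (feq w') (frel w') r' a
        & fsat w' r' p]
  | GAll xs G p => forall w' r',
      link w (prestr (free_vars (GAll xs G p)) r)
           w' (prestr (free_vars (GAll xs G p)) r') ->
      (forall a, List.In a G -> local_atom (feq w') (frel w') r' a) ->
      fsat w' r' p
  end.

Section FrameTheory.
Variable F : frame.
Implicit Types (w : world F) (r s : nat -> option nat).

Lemma feq_l w x y : feq w x y -> feq w x x.
Proof. by move=> xy; apply: feq_trans xy (feq_sym xy). Qed.

Lemma same_value_refl w o : same_value (feq w) o o.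
Proof.
case: (pselect (exists2 a, feq w a a & o = Some a)) => [[a aa oa]|H].
  by left; exists a, a.
by right; split=> a aa oa; apply: H; exists a.
Qed.

Lemma link_refl w r : link w r w r.
Proof. by apply: link_same => x; apply: same_value_refl. Qed.

Lemma link_feq w r w' r' x y a b : link w r w' r' ->
  r x = Some a -> r y = Some b -> feq w a b ->
  exists a' b', [/\ r' x = Some a', r' y = Some b' & feq w' a' b'].
Proof.
move=> l ra rb ab; have /= := @link_atom F _ _ _ _ (Eq x y) l.
by apply; exists a, b.
Qed.

Lemma local_atom_name w r a x : local_atom (feq w) (frel w) r a ->
  x \in atom_vars a -> exists2 z, r x = Some z & feq w z z.
Proof.
case: a => [R xs|y z] /=.
  move=> [zs rzs Rzs] xxs.
  have: r x \in [seq Some i | i <- zs] by rewrite -rzs map_f.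
  by case/mapP=> z zzs rx; exists z => //; apply: frel_name zzs.
case=> a [b [ya zb ab]]; rewrite !inE => /orP[]/eqP->; first by exists a => //; apply: feq_l ab.
by exists b => //; apply: feq_l (feq_sym ab).
Qed.

End FrameTheory.
End Frames.

(** * Nodes and elements of the unravelling *)

Section Tree.
Variables (sigma : vocabulary) (F : frame sigma) (w0 : world F).
Implicit Types (r s : nat -> option nat) (x y : nat).

(* A step [(r, r', w)] leads to the world [w] in which each [r' x] names the
   element that [r x] names in the previous world. *)
Definition step : Type := ((nat -> option nat) * (nat -> option nat) * world F).
Definition node : Type := seq step.
Implicit Types (t : node).

Definition tip t : world F := if t is u :: _ then u.2 else w0.

Fixpoint valid t : Prop :=
  if t is (r, r', w) :: t0 then link (tip t0) r w r' /\ valid t0 else True.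

(* The node at which an element is introduced and its set of names there. *)
Fixpoint origin t y : node * (nat -> Prop) :=
  if t is (r, r', w) :: t0 then
    match pselect (exists a x b, [/\ r x = Some a, r' x = Some b & feq w b y])
    with
    | left h => origin t0 (sval (cid h))
    | right _ => (t, feq w y)
    end
  else ([::], feq w0 y).

Lemma origin_size t y : size (origin t y).1 <= size t.
Proof.
elim: t y => [//|[[r r'] w] t IH] y /=; case: pselect => //= h.
by apply: leq_trans (IH _) _.
Qed.

(** The choice made by [origin] is harmless: links carry equalities both ways, so two candidates
    name one element of the parent. An inherited element never shares the origin of a new one, since
    its origin is a shorter node. *)
Lemma origin_eq t y y' : valid t -> feq (tip t) y y -> feq (tip t) y' y' ->
  (origin t y = origin t y') <-> feq (tip t) y y'.
Proof.
have class (w : world F) z z' : feq w z' z' -> (feq w z = feq w z' <-> feq w z z').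
  move=> zz'; split=> [->//|zz].
  by apply/funext => u; apply/propext; split; apply: feq_trans => //; apply: feq_sym.
elim: t y y' => [|[[r r'] w] t IH] y y' /=.
  by move=> _ yy yy'; rewrite -(class w0 y y' yy'); split=> [[]|->].
move=> [lt vt] yy yy'.
case: pselect => [h|h]; case: pselect => [h'|h'] /=.
- case: (cid h) => a /= [x [b [ra rb by_]]].
  case: (cid h') => a' /= [x' [b' [ra' rb' by_']]].
  have bb : feq w b b := feq_l by_; have bb' : feq w b' b' := feq_l by_'.
  have [c [d [rc rd cd]]] := link_feq (link_sym lt) rb rb bb.
  have [c' [d' [rc' rd' cd']]] := link_feq (link_sym lt) rb' rb' bb'.
  have {rc rd cd} aa : feq (tip t) a a by move: rc rd cd; rewrite ra => -[<-] [<-].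
  have {rc' rd' cd'} aa' : feq (tip t) a' a'.
    by move: rc' rd' cd'; rewrite ra' => -[<-] [<-].
  rewrite IH //; split=> [ea|ey].
    have [e [e' [re re' ee']]] := link_feq lt ra ra' ea.
    move: re re' ee'; rewrite rb rb' => -[<-] [<-] bb2.
    by apply: feq_trans by_'; apply: feq_trans bb2; apply: feq_sym.
  have bb2 : feq w b b'.
    by apply: feq_trans (feq_sym by_'); apply: feq_trans by_ _.
  have [e [e' [re re' ee']]] := link_feq (link_sym lt) rb rb' bb2.
  by move: re re' ee'; rewrite ra ra' => -[<-] [<-].
- split=> [e|ey].
    by have := origin_size t (sval (cid h)); rewrite e /= ltnn.
  case: h'; case: h => a [x [b [ra rb by_]]]; exists a, x, b; split=> //.
  exact: feq_trans by_ _.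
- split=> [e|ey].
    by have := origin_size t (sval (cid h')); rewrite -e /= ltnn.
  case: h; case: h' => a [x [b [ra rb by_]]]; exists a, x, b; split=> //.
  exact: feq_trans by_ (feq_sym _).
- by rewrite -(class w y y' yy'); split=> [[]|->].
Qed.

Lemma origin_old r r' w t x a b : valid ((r, r', w) :: t) ->
  r x = Some a -> r' x = Some b -> feq w b b ->
  feq (tip t) a a /\ origin ((r, r', w) :: t) b = origin t a.
Proof.
move=> /= [lt vt] ra rb bb.
have [c [d [rc rd cd]]] := link_feq (link_sym lt) rb rb bb.
have {rc rd cd} aa : feq (tip t) a a by move: rc rd cd; rewrite ra => -[<-] [<-].
split=> //; case: pselect => [h|[]]; last by exists a, x, b.
case: (cid h) => a' /= [x' [b' [ra' rb' by_']]].
have [e [e' [re re' ee']]] := link_feq (link_sym lt) rb rb' (feq_sym by_').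
move: re re' ee'; rewrite ra ra' => -[<-] [<-] aa'.
by apply/origin_eq => //; [apply: feq_l (feq_sym aa')|apply: feq_sym].
Qed.

Lemma origin_new r r' w t y : valid ((r, r', w) :: t) -> feq w y y ->
  (exists a x b, [/\ r x = Some a, r' x = Some b, feq w b y, feq (tip t) a a
    & origin ((r, r', w) :: t) y = origin t a]) \/
  (origin ((r, r', w) :: t) y).1 = (r, r', w) :: t.
Proof.
move=> vt yy; case: (pselect (exists a x b, [/\ r x = Some a, r' x = Some b & feq w b y])).
  move=> [a [x [b [ra rb by_]]]]; left; exists a, x, b.
  have bb := feq_l by_; have [aa <-] := origin_old vt ra rb bb.
  by split=> //; apply/origin_eq => //; apply: feq_sym.
by move=> h; right => /=; case: pselect.
Qed.

Lemma origin_full t y : size (origin t y).1 = size t -> (origin t y).1 = t.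
Proof.
case: t => [//|[[r r'] w] t] /=; case: pselect => //= h e.
by have := origin_size t (sval (cid h)); rewrite e ltnn.
Qed.

(** Origins are canonical representatives, so the elements of the tree form a subtype rather than a
    quotient by the links. *)
Definition tree_elt : Type :=
  {c : node * (nat -> Prop) |
    exists t y, [/\ valid t, feq (tip t) y y & c = origin t y]}.

Definition value t y : option tree_elt :=
  match pselect (valid t /\ feq (tip t) y y) with
  | left h => Some (exist _ (origin t y)
      (ex_intro _ t (ex_intro _ y (And3 h.1 h.2 erefl))))
  | right _ => None
  end.

Lemma value_some t y z : value t y = Some z <->
  [/\ valid t, feq (tip t) y y & sval z = origin t y].
Proof.
rewrite /value; case: pselect => [[vt yy]|h]; last first.
  by split=> // -[vt yy _]; case: h.
split=> [[<-]//|[_ _ ez]]; congr Some; case: z ez => /= c hc ec.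
exact: eq_exist.
Qed.

Lemma value_name t y : valid t -> feq (tip t) y y -> exists z, value t y = Some z.
Proof.
move=> vt yy; rewrite /value; case: pselect => [h|nh]; first by eexists.
by case: nh.
Qed.

Lemma value_elt (z : tree_elt) : exists t y, value t y = Some z.
Proof. by case: z => c [t [y [vt yy ec]]]; exists t, y; apply/value_some. Qed.

Lemma value_eq t y y' z : value t y = Some z -> value t y' = Some z ->
  feq (tip t) y y'.
Proof.
move=> /value_some[vt yy ez] /value_some[_ yy' ez'].
by apply/origin_eq => //; rewrite -ez.
Qed.

Lemma value_feq t y y' : valid t -> feq (tip t) y y' -> value t y = value t y'.
Proof.
move=> vt yy'; have [z ez] := value_name vt (feq_l yy').
rewrite ez; apply/esym/value_some; case/value_some: ez => _ yy ->; split=> //.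
  exact: feq_l (feq_sym yy').
by apply/origin_eq => //; apply: feq_l (feq_sym yy').
Qed.

Lemma value_old r r' w t x a b : valid ((r, r', w) :: t) ->
  r x = Some a -> r' x = Some b -> feq w b b ->
  value ((r, r', w) :: t) b = value t a.
Proof.
move=> vt ra rb bb; have [aa ec] := origin_old vt ra rb bb.
have vt0 : valid t by case: vt.
have [z ez] := value_name vt0 aa; rewrite ez; apply/value_some.
by split=> //; rewrite ec; case/value_some: ez.
Qed.

Definition introduces t r : Prop :=
  t = [::] \/
  exists x y z, [/\ r x = Some y, value t y = Some z & (sval z).1 = t].

Lemma value_climb t r : valid t -> exists t' r',
  [/\ valid t', link (tip t) r (tip t') r', introduces t' r'
    & forall x, obind (value t) (r x) = obind (value t') (r' x)].
Proof.
elim: t r => [|[[s s'] w] t IH] r vt.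
  by exists [::], r; split=> //; [apply: link_refl|left].
case: (pselect (introduces ((s, s', w) :: t) r)) => [ir|nir].
  by exists ((s, s', w) :: t), r; split=> //; apply: link_refl.
case: (vt) => lk vt0.
have old x y z : r x = Some y -> value ((s, s', w) :: t) y = Some z ->
  exists u a b, [/\ s u = Some a, s' u = Some b, feq w b y & value t a = Some z].
  move=> rx vy; have [_ yy ez] := proj1 (value_some _ _ _) vy.
  case: (origin_new vt yy) => [[a [u [b [sa sb by_ aa eo]]]]|eo].
    by exists u, a, b; split=> //; apply/value_some; rewrite ez.
  by case: nir; right; exists x, y, z; rewrite ez.
(* No element named by [r] is introduced here, so each comes from the parent through some index [u]
   of the step; [f] chooses [u], and [s \op f] names the same tuple one node nearer the root. *)
have /choice[f fP] : forall x, exists fx : option nat,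
    (exists u y a b, [/\ fx = Some u, s u = Some a, s' u = Some b,
       r x = Some y & feq w b y /\ value t a = value ((s, s', w) :: t) y])
    \/ fx = None /\ obind (value ((s, s', w) :: t)) (r x) = None.
  move=> x; case rx: (r x) => [y|] /=; last by exists None; right.
  case vy: (value ((s, s', w) :: t) y) => [z|]; last by exists None; right.
  have [u [a [b [sa sb by_ va]]]] := old x y z rx vy.
  by exists (Some u); left; exists u, y, a, b; split=> //; rewrite va vy.
have [t' [r' [vt' lt' it' et']]] := IH (s \op f) vt0.
exists t', r'; split=> // [|x].
  apply: (link_trans (w' := tip t) (r' := s \op f) _ lt'); apply: (@link_trans _ _ _ _ w (s' \op f)).
    apply: link_same => x; rewrite /pcomp.
    case: (fP x) => [[u [y [a [b [-> sa /= sb -> [by_ _]]]]]]|[-> /= vx]].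
      by left; exists y, b; split=> //; apply: feq_sym.
    right; split=> // y yy rx; move: vx; rewrite rx /=.
    by have [z ->] := @value_name ((s, s', w) :: t) y vt yy.
  by apply: link_comp; apply: link_sym.
rewrite -et' /pcomp.
by case: (fP x) => [[u [y [a [b [-> /= -> sb -> [_ /= ->]]]]]]|[-> /= ->]].
Qed.

(* Two names of the same tuple of the tree are linked: move both nodes towards
   the root until each introduces an element of the tuple, when they coincide. *)
Lemma value_link t t' r r' : valid t -> valid t' ->
  (forall x, obind (value t) (r x) = obind (value t') (r' x)) ->
  link (tip t) r (tip t') r'.
Proof.
move=> /(value_climb r)[t1 [r1 [vt1 lt it1 et]]].
move=> /(value_climb r')[t2 [r2 [vt2 lt' it2 et']]] rr'.
apply: (link_trans lt); apply: (link_trans _ (link_sym lt')).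
have {et et' rr'} e12 x : obind (value t1) (r1 x) = obind (value t2) (r2 x).
  by rewrite -et rr' et'.
(* An element introduced at [t3] and present in [t4] has its origin, which is [t3], on the path from
   [t4] to the root. Applied both ways, this gives nodes of equal depth, hence equal nodes. *)
have deeper t3 t4 r3 r4 : introduces t3 r3 ->
    (forall x, obind (value t3) (r3 x) = obind (value t4) (r4 x)) ->
    size t3 <= size t4 /\ (size t3 = size t4 -> t3 = t4).
  move=> [->|[x [y [z [rx vy oz]]]]] e34.
    by split=> // /esym/size0nil ->.
  have := e34 x; rewrite rx /= vy; case: (r4 x) => //= y' /esym/value_some[_ _ ez].
  have := origin_size t4 y'; rewrite -ez oz; split=> // st.
  by rewrite -oz ez origin_full // -ez oz.
have e21 x := esym (e12 x).
have [le12 eq12] := deeper _ _ _ _ it1 e12.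
have [le21 _] := deeper _ _ _ _ it2 e21.
have {eq12} t12 : t1 = t2 by apply: eq12; apply/eqP; rewrite eqn_leq le12.
move: e12; rewrite -t12 => e12; apply: link_same => x.
case vx: (obind (value t1) (r1 x)) => [z|].
  move: vx (vx); rewrite {2}e12.
  case: (r1 x) => //= a va; case: (r2 x) => //= b vb; left; exists a, b.
  by split=> //; apply: value_eq va vb.
right; split=> a aa ra; [move: vx|move: vx; rewrite e12]; rewrite ra /=.
  by have [z ->] := value_name vt1 aa.
by have [z ->] := value_name vt1 aa.
Qed.
End Tree.

Lemma map_Some_ex (T : Type) n (f : nat -> option T) (xs : n.-tuple nat) :
  (forall x, x \in xs -> exists y, f x = Some y) ->
  exists v : n.-tuple T, map f xs = map Some v.
Proof.
move=> fx; suff [v ev] : exists v : seq T, map f xs = map Some v.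
  have sv : size v == n by rewrite -(size_map (Some : T -> option T)) -ev size_map size_tuple.
  by exists (Tuple sv).
have {}fx : forall x, x \in tval xs -> exists y, f x = Some y by [].
elim: (tval xs) fx => [|x s IH] fx; first by exists [::].
have [y fy] := fx x (mem_head _ _).
have [|v ev] := IH; first by move=> z zs; apply: fx; rewrite inE zs orbT.
by exists (y :: v); rewrite /= fy ev.
Qed.

(** * Satisfaction in the unravelling *)

Section TreeStructure.
Variables (sigma : vocabulary) (F : frame sigma) (w0 : world F).
Notation node := (node F).
Notation valid := (@valid sigma F w0).
Notation value := (@value sigma F w0).
Notation tip := (@tip sigma F w0).

(* The nodes containing a given element form a connected part of the tree,
   with root the node introducing the element. *)
Lemma value_origin (t : node) y y' z z' :
  value t y = Some z -> value t y' = Some z' ->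
  size (sval z').1 <= size (sval z).1 ->
  exists y0, value (sval z).1 y0 = Some z'.
Proof.
elim: t y y' => [|[[s s'] w] t IH] y y' vz vz'.
  have /value_some[_ _ ->] := vz.
  by move=> _; exists y'.
have /value_some[vt yy ez] := vz; have /value_some[_ yy' ez'] := vz'.
move=> le; case: (origin_new vt yy) => [[a [x [b [sa sb _ aa eo]]]]|eo]; last first.
  by exists y'; rewrite ez eo.
have va : value t a = Some z.
  by apply/value_some; rewrite ez; split=> //; case: vt.
case: (origin_new vt yy') => [[a' [x' [b' [sa' sb' _ aa' eo']]]]|eo'].
  apply: (IH a a' va _ le).
  by apply/value_some; rewrite ez'; split=> //; case: vt.
move: le; rewrite ez' eo' ez eo => le.
by have := leq_trans le (origin_size w0 t a); rewrite ltnn.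
Qed.

(* The Helly property of subtrees. *)
Lemma value_common (e : nat -> option (tree_elt w0)) (D : seq nat) :
  (forall u v z z', u \in D -> v \in D -> e u = Some z -> e v = Some z' ->
     exists t y y', value t y = Some z /\ value t y' = Some z') ->
  exists t r, valid t /\ {in D, e =1 value t \op r}.
Proof.
move=> pair; pose f x := if e x is Some z then (size (sval z).1).+1 else 0.
have [noD|[u [uD umax]]] : (forall v, v \in D -> f v = 0) \/
    exists u, u \in D /\ forall v, v \in D -> f v <= f u.
  elim: (D) => [|x s [IH|[u [us IH]]]]; first by left.
    right; exists x; split; first exact: mem_head.
    by move=> v; rewrite inE => /orP[/eqP->|/IH ->].
  right; case: (leqP (f x) (f u)) => le.
    exists u; split; first by rewrite inE us orbT.
    by move=> v; rewrite inE => /orP[/eqP->|/IH].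
  exists x; split; first exact: mem_head.
  move=> v; rewrite inE => /orP[/eqP->//|/IH le']; exact: leq_trans le' (ltnW le).
  exists [::], (fun=> None); split=> // v /noD.
  by rewrite /f /pcomp; case: (e v).
case eu: (e u) => [z|]; last first.
  exists [::], (fun=> None); split=> // v /umax.
  by rewrite /f /pcomp eu; case: (e v).
have [t [y [_ [vz _]]]] := pair _ _ _ _ uD uD eu eu.
have vt : valid (sval z).1.
  by have [y0 /value_some[]] := value_origin vz vz (leqnn _).
have /choice[r rP] : forall v, exists o, v \in D -> e v = obind (value (sval z).1) o.
  move=> v; case vD: (v \in D); last by exists None.
  case ev: (e v) => [z'|]; last by exists None.
  have [t' [y1 [y2 [v1 v2]]]] := pair _ _ _ _ uD vD eu ev.
  have [|y0 vy0] := value_origin v1 v2.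
    by have := umax v vD; rewrite /f eu ev.
  by exists (Some y0) => /= _; rewrite vy0.
by exists (sval z).1, r; split.
Qed.

Definition tree : structure sigma :=
  @Structure sigma (tree_elt w0) (fun R v => exists t (zs : (arity R).-tuple nat),
    [/\ valid t, frel (tip t) zs & map (value t) zs = map Some v]).

(** A fact may be witnessed at a distant node, but [value_link] and [link_atom] carry it to every
    node that names its tuple. *)
Lemma sat_atom_tree (e : assignment tree) t r a : valid t ->
  {in atom_vars a, e =1 value t \op r} ->
  sat_atom e a <-> local_atom (feq (tip t)) (@frel _ _ (tip t)) r a.
Proof.
move=> vt; case: a => [R xs|x y] /= er; last first.
  have -> := er x (mem_head _ _).
  have -> : e y = (value t \op r) y by apply: er; rewrite !inE eqxx orbT.
  rewrite /pcomp; case: (r x) => [a|] /=; last by split=> [[]|[? [? []]]].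
  case: (r y) => [b|] /=; last by split=> [[]|[? [? []]]].
  split=> [[v va vb]|[_ [_ [[<-] [<-] ab]]]].
    by exists a, b; split=> //; apply: value_eq va vb.
  have [v va] := value_name vt (feq_l ab).
  by exists v => //; rewrite -va; apply/esym/value_feq.
have {}er : map e xs = map (obind (value t)) (map r xs).
  by rewrite -map_comp; apply/eq_in_map.
split=> [[v ev [t' [zs [vt' Rzs ezs]]]]|[zs rzs Rzs]]; last first.
  have [|v ev] := @map_Some_ex _ _ (value t) zs.
    by move=> z zzs; apply: value_name => //; apply: frel_name zzs.
  exists v; last by exists t, zs.
  by rewrite er rzs -map_comp -ev.
(* [xs] may have repetitions, so the two names are compared position by
   position. *)
pose pos (T : Type) (s : seq (option T)) m := nth None s m.
have iotaE (s : seq (option nat)) : size s = arity R ->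
    map (pos _ s) (iota_tuple (arity R) 0) = s.
  by move=> <-; rewrite -[RHS](mkseq_nth None).
have sr : size (map r xs) = arity R by rewrite size_map size_tuple.
have sz : size (map Some zs) = arity R by rewrite size_map size_tuple.
have lk : link (tip t') (pos _ (map Some zs)) (tip t) (pos _ (map r xs)).
  apply: value_link => // m; rewrite /pos.
  have obn (s : seq (option nat)) t1 : obind (value t1) (nth None s m) =
      nth None (map (obind (value t1)) s) m.
    by case: (ltnP m (size s)) => h; [rewrite (nth_map None)|rewrite !nth_default ?size_map].
  by rewrite !obn -er ev -ezs -[in LHS]map_comp.
have /= := @link_atom _ _ _ _ _ _ (Rel (iota_tuple (arity R) 0)) lk.
case=> [|zs' ezs' Rzs'].
  by exists zs => //; apply: iotaE.
by exists zs' => //; rewrite -ezs' -[LHS]iotaE.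
Qed.

Lemma sat_atom_common (e : assignment tree) a u v z z' : sat_atom e a ->
  u \in atom_vars a -> v \in atom_vars a -> e u = Some z -> e v = Some z' ->
  exists t y y', value t y = Some z /\ value t y' = Some z'.
Proof.
case: a => [R xs|x y] /=.
  move=> [s es [t [zs [vt Rzs ezs]]]] ux vx eu ev.
  have inz (c : tree_elt w0) w : w \in xs -> e w = Some c -> exists y, value t y = Some c.
    move=> wx ew; have [i ilt iw] : exists2 i, i < size xs & nth 0 xs i = w.
      by exists (index w xs); rewrite ?index_mem ?nth_index.
    have : nth None (map e xs) i = Some c by rewrite (nth_map 0) // iw.
    rewrite es -ezs (nth_map 0); first by exists (nth 0 zs i).
    by move: ilt; rewrite !size_tuple.
  have [y1 ?] := inz _ _ ux eu; have [y2 ?] := inz _ _ vx ev.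
  by exists t, y1, y2.
move=> [c ex ey]; have [t [y0 vy0]] := value_elt c.
rewrite !inE => ux vx eu ev; exists t, y0, y0.
have h w c' : (w == x) || (w == y) -> e w = Some c' -> c' = c.
  by case/orP=> /eqP->; rewrite ?ex ?ey => -[].
by rewrite (h u z) // (h v z').
Qed.

(** Two variables of the scope share a bag: through a conjunct of the guard if one is quantified,
    through [t] if both are free. The Helly property then puts the whole scope in one bag, possibly
    far from [t]. *)
Lemma tree_move_down g (t : node) r (e e' : assignment tree) xs G p : valid t ->
  is_guard g xs G p ->
  {in free_vars (GEx xs G p), e =1 value t \op r} ->
  reassigns xs e e' -> sat_guard e' G ->
  exists t' r', [/\ valid t', {in scope xs G p, e' =1 value t' \op r'}
    & link (tip t) (prestr (free_vars (GEx xs G p)) r)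
           (tip t') (prestr (free_vars (GEx xs G p)) r')].
Proof.
move=> vt gd er re /sat_guardP eG.
set ys := free_vars _ in er *.
have e'y : {in ys, e' =1 value t \op r}.
  move=> y yys; rewrite -er //; have := re y.
  by move: yys; rewrite mem_free_vars_ex => /andP[/negbTE ->].
have [|t' [r' [vt' er']]] := @value_common e' (scope xs G p).
  move=> u v z z' us vs eu ev.
  have side x x' c c' : x \in xs -> x' \in scope xs G p -> e' x = Some c ->
      e' x' = Some c' -> exists t y y', value t y = Some c /\ value t y' = Some c'.
    move=> xx x's ex ex'; have [a [aG xa x'a]] := is_guard_loose gd xx x's.
    exact: sat_atom_common (eG a aG) xa x'a ex ex'.
  case uxs: (u \in xs); first exact: (side u v).
  case vxs: (v \in xs).
    have [t1 [y [y' [v1 v2]]]] := side _ _ _ _ vxs us ev eu.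
    by exists t1, y', y.
  have uy : u \in ys by move: us; rewrite mem_scope uxs.
  have vy : v \in ys by move: vs; rewrite mem_scope vxs.
  move: eu ev; rewrite !e'y // /pcomp.
  case: (r u) => //= a va; case: (r v) => //= b vb.
  by exists t, a, b.
exists t', r'; split=> //; apply: value_link => // x.
rewrite /prestr; case: ifP => // xys.
by rewrite -[RHS](er' x) ?(scope_free xys) // -[LHS](e'y x).
Qed.

(** The world [w'] is attached to [t] as a new child, so that every link of the frame is realised by
    an edge at every node. *)
Lemma tree_move_up g (t : node) r (e : assignment tree) xs G p w' r' : valid t ->
  is_guard g xs G p ->
  {in free_vars (GEx xs G p), e =1 value t \op r} ->
  link (tip t) (prestr (free_vars (GEx xs G p)) r)
       w' (prestr (free_vars (GEx xs G p)) r') ->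
  (forall a, List.In a G -> local_atom (feq w') (@frel _ _ w') r' a) ->
  exists t' e', [/\ valid t', tip t' = w', reassigns xs e e'
    & {in scope xs G p, e' =1 value t' \op r'}].
Proof.
move=> vt gd er lk wG; set ys := free_vars _ in er lk *.
pose t' : node := (prestr ys r, prestr ys r', w') :: t.
have vt' : valid t' by [].
exists t', (fun x => if x \in xs then (value t' \op r') x else e x).
split=> // [x|x]; case xxs: (x \in xs) => //.
  have /guard_varsP[a aG xa] := is_guard_quantified gd xxs.
  have [z rz zz] := local_atom_name (wG a aG) xa.
  by rewrite /pcomp rz /=; have [c ->] := @value_name _ _ w0 t' z vt' zz.
rewrite mem_scope xxs /= => xys; rewrite er // /pcomp.
have rx : prestr ys r x = r x by rewrite prestr_in.
have rx' : prestr ys r' x = r' x by rewrite prestr_in.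
have lk' := link_sym lk.
(* A link carries the atom [Eq x x] both ways, so [r x] is a name in the old world exactly when
   [r' x] is one in the new world. *)
case ex: (r x) => [a|] /=; last first.
  case ex': (r' x) => [b|] //=; case vb: (value t' b) => [c|//].
  have /value_some[_ bb _] := vb.
  have [] := link_feq lk' (etrans rx' ex') (etrans rx' ex') bb.
  by move=> a [a' [ra _ _]]; rewrite rx ex in ra.
case va: (value t a) => [c|].
  have /value_some[_ aa _] := va.
  have [b [b' [eb eb' bb']]] := link_feq lk (etrans rx ex) (etrans rx ex) aa.
  rewrite -rx' eb /=; rewrite -va; apply/esym.
  by apply: (@value_old _ _ _ _ _ _ _ x) => //; [rewrite rx|apply: feq_l bb'].
case ex': (r' x) => [b|//] /=; case vb: (value t' b) => [c|//].
have /value_some[_ bb _] := vb.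
have [a1 [a2 [ra1 ra2 a12]]] := link_feq lk' (etrans rx' ex') (etrans rx' ex') bb.
move: ra1; rewrite rx ex => -[ea1]; have := value_name vt (feq_l a12).
by rewrite -ea1 va => -[].
Qed.

Lemma sat_guard_tree t r (e : assignment tree) xs G p : valid t ->
  {in scope xs G p, e =1 value t \op r} ->
  sat_guard e G <->
  forall a, List.In a G -> local_atom (feq (tip t)) (@frel _ _ (tip t)) r a.
Proof.
move=> vt er; rewrite sat_guardP.
have h a : List.In a G ->
    sat_atom e a <-> local_atom (feq (tip t)) (@frel _ _ (tip t)) r a.
  by move=> aG; apply: sat_atom_tree => // x xa; apply: er; apply: scope_atom xa.
by split=> H a aG; apply/(h a aG)/H.
Qed.

(** The two moves are converse to each other, so the equivalence holds for all guarded formulas,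
    with negations and universal quantifiers. *)
Lemma sat_tree g phi (t : node) r (e : assignment tree) :
  guarded g phi -> valid t -> {in free_vars phi, e =1 value t \op r} ->
  sat e phi <-> fsat (tip t) r phi.
Proof.
elim: phi t r e => //= [a|p IH|p IHp q IHq|p IHp q IHq|xs G p IH|xs G p IH] t r e.
- by move=> _ vt er; apply: sat_atom_tree.
- by move=> gp vt er; rewrite (IH t r e).
1,2: move=> /andP[gp gq] vt er; rewrite (IHp t r e) // ?(IHq t r e) //.
1-4: by move=> x xp; apply: er; rewrite mem_cat xp ?orbT.
all: move=> /andP[gd gp] vt er.
- split=> [[e' [re [eG sp]]]|[w' [r' [lk wG sp]]]].
    have [t' [r' [vt' er' lk]]] := tree_move_down vt gd er re eG.
    exists (tip t'), r'; split=> //; first exact/(sat_guard_tree vt' er').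
    by apply/(IH t' r' e') => // x xp; apply: er'; apply: scope_body.
  have [t' [e' [vt' tw re er']]] := tree_move_up vt gd er lk wG.
  exists e'; split=> //; split; first by apply/(sat_guard_tree vt' er'); rewrite tw.
  by apply/(IH t' r') => //; [move=> x xp; apply: er'; apply: scope_body|rewrite tw].
- split=> [H w' r' lk wG|H e' re eG].
    have [t' [e' [vt' tw re er']]] := tree_move_up vt gd er lk wG.
    rewrite -tw; apply/(IH t' r' e') => //.
      by move=> x xp; apply: er'; apply: scope_body.
    by apply: H => //; apply/(sat_guard_tree vt' er'); rewrite tw.
  have [t' [r' [vt' er' lk]]] := tree_move_down vt gd er re eG.
  apply/(IH t' r') => //; first by move=> x xp; apply: er'; apply: scope_body.
  by apply: H => //; apply/(sat_guard_tree vt' er').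
Qed.

(** The map sends an element to its value at the origin; compatibility along single edges already
    makes all bags containing the element agree. *)
Lemma tree_hom (B : structure sigma) (v : node -> nat -> option B) :
  (forall t x y, valid t -> feq (tip t) x y ->
     isSome (v t x) /\ v t x = v t y) ->
  (forall t R (zs : (arity R).-tuple nat), valid t -> frel (tip t) zs ->
     exists2 b : (arity R).-tuple B, map (v t) zs = map Some b & interp b) ->
  (forall r r' w t x a b, valid ((r, r', w) :: t) ->
     r x = Some a -> r' x = Some b -> feq w b b ->
     v ((r, r', w) :: t) b = v t a) ->
  exists h : tree -> B, is_hom h.
Proof.
move=> veq vrel vold.
have vorigin t t' y y' : valid t -> valid t' -> feq (tip t) y y ->
    feq (tip t') y' y' -> origin w0 t y = origin w0 t' y' -> v t y = v t' y'.
  have top s y1 : valid s -> feq (tip s) y1 y1 -> exists y0,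
      [/\ valid (origin w0 s y1).1, feq (tip (origin w0 s y1).1) y0 y0,
        origin w0 (origin w0 s y1).1 y0 = origin w0 s y1
        & v s y1 = v (origin w0 s y1).1 y0].
    elim: s y1 => [|[[r r'] w] s IH] y1 vs yy; first by exists y1.
    case: (origin_new vs yy) => [[a [x [b [rx rx' by1 aa ->]]]]|->]; last by exists y1.
    have [|y0 [v1 v2 v3 v4]] := IH a _ aa; first by case: vs.
    exists y0; split=> //; rewrite -v4.
    have [_ <-] := veq _ _ _ vs by1.
    exact: (vold _ _ _ _ _ _ _ vs rx rx' (feq_l by1)).
  move=> vt vt' yy yy' eo.
  have [y0 [v1 v2 v3 ->]] := top _ _ vt yy.
  have [y0' [_ v2' v3' ->]] := top _ _ vt' yy'.
  rewrite -eo in v2' v3' *.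
  by apply: (veq _ _ _ v1 _).2; apply/(origin_eq v1 v2 v2'); rewrite v3 v3'.
have /choice[h hP] : forall c : tree_elt w0, exists b : B,
    forall t y, value t y = Some c -> v t y = Some b.
  move=> c; have [t [y vy]] := value_elt c.
  have /value_some[vt yy ec] := vy.
  have [] := veq _ _ _ vt yy; case vb: (v t y) => [b|] // _ _.
  exists b => t' y' /value_some[vt' yy' ec']; rewrite -vb.
  by apply: vorigin; rewrite // -ec -ec'.
exists h => R c [t [zs [vt Rzs ezs]]].
have [b eb Rb] := vrel _ _ _ vt Rzs.
suff -> : map_tuple h c = b by [].
apply/val_inj/(inj_map Some_inj); rewrite -eb /=.
elim: (tval zs) (tval c) ezs => [|z s IH] [|c1 s'] //= [vz /IH ->].
by rewrite (hP _ _ _ vz).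
Qed.
End TreeStructure.

(** * The frame of assignments *)

Lemma tree_map (sigma : vocabulary) (F F' : frame sigma)
    (m : world F -> world F') (w0 : world F) :
  (forall w x y, feq w x y -> feq (m w) x y) ->
  (forall w R (zs : (arity R).-tuple nat), frel w zs -> frel (m w) zs) ->
  (forall w r w' r', link w r w' r' -> link (m w) r (m w') r') ->
  exists h : tree w0 -> tree (m w0), is_hom h.
Proof.
move=> meq mrel mlink; pose mt : node F -> node F' := map (fun u => (u.1, m u.2)).
have tipm t : tip (m w0) (mt t) = m (tip w0 t) by case: t.
have validm t : valid w0 t -> valid (m w0) (mt t).
  elim: t => //= -[[r r'] w] t IH [lk /IH vt] /=; split=> //.
  by rewrite tipm; apply: mlink.
apply: (@tree_hom _ _ _ (tree (m w0)) (fun t => value (m w0) (mt t))).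
- move=> t x y vt xy; have xy' : feq (tip (m w0) (mt t)) x y.
    by rewrite tipm; apply: meq.
  rewrite (value_feq (validm t vt) xy').
  by have [z ->] := value_name (validm t vt) (feq_l (feq_sym xy')).
- move=> t R zs vt Rzs.
  have Rzs' : frel (tip (m w0) (mt t)) zs by rewrite tipm; apply: mrel.
  have [|v ev] := @map_Some_ex _ _ (value (m w0) (mt t)) zs.
    by move=> z zzs; apply: value_name (validm t vt) (frel_name Rzs' zzs).
  by exists v => //; exists (mt t), zs; split=> //; apply: validm.
- move=> r r' w t x a b vt rx rx' bb.
  exact: (value_old (validm _ vt) rx rx' (meq _ _ _ bb)).
Qed.

Section Names.
Variables (sigma : vocabulary) (S : seq (symbol sigma)).

Definition names_eq (A : structure sigma) (e : assignment A) x y : Prop :=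
  sat_atom e (Eq x y).

(** Only the finitely many symbols of [S] survive in the tree: those outside are not recorded by
    types and need not be matched in the game. *)
Definition names_rel (A : structure sigma) (e : assignment A) R
  (zs : (arity R).-tuple nat) : Prop := List.In R S /\ sat_atom e (Rel zs).

Lemma local_atomE (A : structure sigma) (e : assignment A) r a :
  local_atom (names_eq e) (@names_rel A e) r a <->
  atom_symbols S a /\ sat_atom (e \op r) a.
Proof.
case: a => [R xs|x y] /=.
  split=> [[zs rzs [RS [v ev Rv]]]|[RS [v ev Rv]]].
    split=> //; exists v => //.
    rewrite -ev (eq_map (_ : e \op r =1 obind e \o r)) // map_comp rzs -map_comp.
    exact: eq_map.
  have [|zs ezs] := @map_Some_ex _ _ r xs.
    move=> x xxs; have := map_Some_def ev xxs.
    by rewrite /pcomp; case: (r x) => [z|] //; exists z.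
  exists zs => //; split=> //; exists v => //.
  rewrite -ev (eq_map (_ : e \op r =1 obind e \o r)) // map_comp ezs -map_comp.
  exact: eq_map.
split=> [[a [b [rx ry [v ea eb]]]]|[_ [v]]].
  by split=> //; exists v; rewrite /pcomp ?rx ?ry.
rewrite /pcomp; case rx: (r x) => [a|//] /= ea; case ry: (r y) => [b|//] /= eb.
by exists a, b; split=> //; exists v.
Qed.

Lemma same_value_comp (A : structure sigma) (e : assignment A)
    (r r' : nat -> option nat) :
  (forall x, same_value (names_eq e) (r x) (r' x)) -> e \op r = e \op r'.
Proof.
move=> rr'; apply/funext => x; rewrite /pcomp.
case: (rr' x) => [[a [b [-> -> /= [v -> ->]]]]//|[nr nr']].
have no o : (forall a, names_eq e a a -> o <> Some a) -> obind e o = None.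
  case: o => //= a na; case ea: (e a) => [v|//].
  by case: (na a) => //; exists v.
by rewrite !no.
Qed.

Lemma names_eq_trans (A : structure sigma) (e : assignment A) x y z :
  names_eq e x y -> names_eq e y z -> names_eq e x z.
Proof. by move=> [v ex ey] [v' ey' ez]; exists v; rewrite // ez -ey' ey. Qed.

Lemma names_rel_name (A : structure sigma) (e : assignment A) R
    (zs : (arity R).-tuple nat) z :
  names_rel e zs -> z \in zs -> names_eq e z z.
Proof.
move=> [_ /sat_atom_def ezs] /ezs; case ez: (e z) => [v|//] _.
by exists v.
Qed.

(** Bags are arbitrary partial tuples of [A]; guards enter only when formulas are evaluated. *)
Definition assignment_frame (A : structure sigma) : frame sigma.
Proof.
refine (@Frame sigma (assignment A) (@names_eq A) (@names_rel A)
  (fun e r e' r' => e \op r = e' \op r') _ _ _ _ _ _ _ _).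
- by move=> e x y [v ex ey]; exists v.
- exact: names_eq_trans.
- exact: names_rel_name.
- exact: same_value_comp.
- by [].
- by move=> w r w' r' w'' r'' ->.
- by move=> w r w' r' s ww'; rewrite !pcompA ww'.
- by move=> w r w' r' a ww' /local_atomE[aS sa]; apply/local_atomE; rewrite -ww'.
Defined.

Lemma fsat_assignment g (A : structure sigma) phi (e : assignment A) r :
  guarded g phi -> symbols_in S phi ->
  @fsat sigma (assignment_frame A) e r phi <-> sat (e \op r) phi.
Proof.
have atG G (e' : assignment A) r' : (forall a, List.In a G -> atom_symbols S a) ->
    sat_guard (e' \op r') G <->
    forall a, List.In a G -> local_atom (names_eq e') (@names_rel A e') r' a.
  move=> GS; rewrite sat_guardP; split=> H a aG.
    by apply/local_atomE; split; [exact: GS|exact: H].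
  by have /local_atomE[] := H a aG.
(* A linked world may disagree with the current one outside the scope, which a reassignment of [xs]
   may not; [mix] takes only the values on [xs] from it. *)
pose mix (e1 e2 : assignment A) (xs : seq nat) x := if x \in xs then e2 x else e1 x.
have mixP g' xs G p (e1 e2 : assignment A) : is_guard g' xs G p ->
    prestr (free_vars (GEx xs G p)) e1 = prestr (free_vars (GEx xs G p)) e2 ->
    sat_guard e2 G ->
    reassigns xs e1 (mix e1 e2 xs) /\ {in scope xs G p, mix e1 e2 xs =1 e2}.
  move=> gd e12 eG; split=> x.
    rewrite /mix; case xxs: (x \in xs) => //.
    exact: sat_guard_def eG (is_guard_quantified gd xxs).
  rewrite mem_scope /mix; case xxs: (x \in xs) => //= xys.
  by rewrite -(prestr_in e1 xys) e12 prestr_in.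
have reas xs G p (e1 e2 : assignment A) : reassigns xs e1 e2 ->
    prestr (free_vars (GEx xs G p)) e1 = prestr (free_vars (GEx xs G p)) e2.
  move=> re; apply: eq_prestr => x; rewrite mem_free_vars_ex => /andP[xxs _].
  by have := re x; rewrite (negbTE xxs).
elim: phi e r => /= [a|||p IH|p IHp q IHq|p IHp q IHq|xs G p IH|xs G p IH] e r //.
- by move=> _ aS; rewrite local_atomE; split=> [[]|].
- by move=> gp pS; rewrite IH.
1,2: by move=> /andP[gp gq] [pS qS]; rewrite IHp // IHq.
all: move=> /andP[gd gp] [GS pS].
- split=> [[e' [r' [lk eG]]]|[e' [re [eG sp]]]].
    rewrite IH // => sp; move/(atG _ _ _ GS): eG => eG; rewrite !pcomp_restr in lk.
    have [re mE] := mixP _ _ _ _ _ _ gd lk eG; exists (mix (e \op r) (e' \op r') xs).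
    split=> //; split.
      by apply: sat_guard_ext eG => x xG; rewrite mE // scope_guard.
    by apply: (proj1 (sat_ext _) sp) => x xp; rewrite mE // scope_body.
  exists e', Some; split; first by rewrite !pcomp_restr; apply: reas.
    by apply/(atG _ _ _ GS).
  by rewrite IH.
- split=> [H e' re eG|H e' r' lk].
    have := H e' Some; rewrite IH //; apply; first by rewrite !pcomp_restr; apply: reas.
    by apply/(atG _ _ _ GS).
  move/(atG _ _ _ GS) => eG; rewrite IH //; rewrite !pcomp_restr in lk.
  have [re mE] := mixP _ _ _ _ _ _ gd lk eG.
  have := H _ re; rewrite (sat_ext (e := mix (e \op r) (e' \op r') xs) (e' := e' \op r')).
    by apply; apply: sat_guard_ext eG => x xG; rewrite mE // scope_guard.
  by move=> x xp; rewrite mE // scope_body.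
Qed.

End Names.

(** * Primitive positive formulas *)

Section Fragment.
Variables (sigma : vocabulary) (g : guarding).
Variables (V : seq nat) (S : seq (symbol sigma)).
Implicit Types (p q : formula sigma) (G : seq (atom sigma)) (f : nat -> nat).

Definition fragment i p : Prop :=
  [/\ primitive_positive p, guarded g p, rank p <= i, {subset all_vars p <= V}
    & symbols_in S p].

Definition rename_atom f (a : atom sigma) : atom sigma :=
  match a with Rel _ xs => Rel (map_tuple f xs) | Eq x y => Eq (f x) (f y) end.

Lemma atom_vars_rename f a : atom_vars (rename_atom f a) = map f (atom_vars a).
Proof. by case: a. Qed.

Lemma sat_atom_rename (A : structure sigma) (e : assignment A) f a :
  sat_atom e (rename_atom f a) <-> sat_atom (fun x => e (f x)) a.
Proof. by case: a => //= R xs; rewrite -map_comp. Qed.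

Lemma guard_vars_rename f G :
  guard_vars (map (rename_atom f) G) = map f (guard_vars G).
Proof.
elim: G => //= a G IH.
by rewrite /guard_vars /= map_cat atom_vars_rename -IH.
Qed.

Lemma is_guard_rename f xs G p q : is_guard g xs G p ->
  {subset free_vars q <= map f (free_vars p)} ->
  is_guard g (map f xs) (map (rename_atom f) G) q.
Proof.
move=> gd qp.
have sc : {subset map f xs ++ guard_vars (map (rename_atom f) G) ++ free_vars q
    <= map f (xs ++ guard_vars G ++ free_vars p)}.
  move=> x; rewrite guard_vars_rename !map_cat !mem_cat.
  by case/or3P => [->|->|/qp ->]; rewrite ?orbT.
move: gd; rewrite /is_guard; case: g.
  case: G sc => [//|a [|//]] sc /allP aP; apply/allP => x /sc/mapP[y ysc ->].
  by rewrite atom_vars_rename map_f // (aP y ysc).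
move=> /allP aP; apply/allP => _ /mapP[u uxs ->]; apply/allP => x /sc/mapP[y ysc ->].
have /allP/(_ y ysc)/has_atomP[a aG /andP[ua ya]] := aP u uxs.
apply/has_atomP; exists (rename_atom f a); first exact: List.in_map.
by rewrite atom_vars_rename !map_f.
Qed.

Lemma fresh_injection (xs zs : seq nat) : uniq V -> {subset xs <= V} ->
  size (undup xs) + size (undup zs) <= size V ->
  exists j : nat -> nat, {in xs &, injective j} /\
    forall x, x \in xs -> (j x \in V) && (j x \notin zs).
Proof.
move=> uV sxV le; pose free := [seq v <- V | v \notin zs].
have lef : size (undup xs) <= size free.
  have : size V <= size (undup zs) + size free.
    rewrite -(count_predC (mem zs) V) size_filter leq_add2r -size_filter.
    apply: uniq_leq_size; first exact: filter_uniq.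
    by move=> x; rewrite mem_filter mem_undup => /andP[].
  by move=> leV; rewrite -(leq_add2r (size (undup zs))) (leq_trans le) // addnC.
have ilt x : x \in xs -> index x (undup xs) < size free.
  by move=> xxs; apply: leq_trans lef; rewrite index_mem mem_undup.
exists (fun x => nth 0 free (index x (undup xs))); split=> [x y xxs yxs|x xxs].
  move=> /eqP; rewrite nth_uniq ?ilt ?filter_uniq // => /eqP ii.
  by rewrite -(nth_index 0 (_ : x \in undup xs)) ?mem_undup // ii nth_index ?mem_undup.
by have := mem_nth 0 (ilt x xxs); rewrite mem_filter andbC.
Qed.

(* Substitution stays within the fragment: the variables outside the image of
   the free ones are enough to rename the bound ones. *)
Lemma fragment_subst i p f : uniq V -> fragment i p ->
  {in free_vars p, forall x, f x \in V} ->
  exists q, [/\ fragment i q, {subset free_vars q <= map f (free_vars p)}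
    & forall (A : structure sigma) (e : assignment A),
        sat e q <-> sat (fun x => e (f x)) p].
Proof.
move=> uV; elim: p i f =>
  /= [a|||p1 _|p1 IH1 p2 IH2|p1 _ p2 _|xs G p IH|xs G p _] i f;
  try by case.
- move=> [_ _ _ _ aS] fV; exists (Atom (rename_atom f a)); split.
  + split=> //=; last by case: a aS {fV}.
    by move=> x; rewrite atom_vars_rename => /mapP[y /fV yV ->].
  + by move=> x /=; rewrite atom_vars_rename.
  + by move=> A e /=; apply: sat_atom_rename.
- by move=> [*]; exists Top.
- move=> [/= /andP[pp1 pp2] /andP[g1 g2]]; rewrite geq_max => /andP[r1 r2] sV [S1 S2] fV.
  have [||q1 [f1 v1 s1]] := IH1 i f.
    by split=> // x xp; apply: sV; rewrite mem_cat xp.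
    by move=> x xp; apply: fV; rewrite mem_cat xp.
  have [||q2 [f2 v2 s2]] := IH2 i f.
    by split=> // x xp; apply: sV; rewrite mem_cat xp orbT.
    by move=> x xp; apply: fV; rewrite mem_cat xp orbT.
  exists (And q1 q2); split.
  + case: f1 f2 => [? ? ? sV1 ?] [? ? ? sV2 ?]; split=> /=.
    * exact/andP.
    * exact/andP.
    * by rewrite geq_max; apply/andP.
    * by move=> x; rewrite mem_cat => /orP[/sV1|/sV2].
    * by [].
  + move=> x /=; rewrite map_cat !mem_cat => /orP[/v1->//|/v2->].
    by rewrite orbT.
  + by move=> A e /=; rewrite s1 s2.
case: i => [[]//|i] [/= pp /andP[gd gp] rk sV [GS pS]] fV.
set ys := [seq y <- _ | _] in fV *.
have ysP y : y \in ys = (y \notin xs) && ((y \in guard_vars G) || (y \in free_vars p)).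
  by rewrite mem_filter mem_cat.
have sxV : {subset xs <= V} by move=> x xxs; apply: sV; rewrite mem_cat xxs.
have sGV : {subset guard_vars G <= V}.
  by move=> x xG; apply: sV; rewrite !mem_cat xG orbT.
have spV : {subset all_vars p <= V}.
  by move=> x xp; apply: sV; rewrite !mem_cat xp !orbT.
have syV : {subset ys <= V}.
  by move=> y; rewrite ysP => /andP[_ /orP[/sGV//|/free_vars_sub/spV]].
(* There is room for [xs]: [xs] and [ys] are disjoint in [V], and [f] may merge variables of [ys]
   but not multiply them. *)
have [|j [jinj jP]] := @fresh_injection xs (map f ys) uV sxV.
  have : size (undup (map f ys)) <= size (undup ys).
    rewrite -(size_map f (undup ys)); apply: uniq_leq_size; first exact: undup_uniq.
    by move=> x; rewrite mem_undup => /mapP[y yys ->]; rewrite map_f // mem_undup.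
  move=> le; apply: leq_trans (_ : size (undup xs ++ undup ys) <= _).
    by rewrite size_cat leq_add2l.
  apply: uniq_leq_size.
    rewrite cat_uniq !undup_uniq andbT; apply/hasPn => y.
    by rewrite !mem_undup ysP => /andP[].
  by move=> x; rewrite mem_cat !mem_undup => /orP[/sxV|/syV].
pose f' x := if x \in xs then j x else f x.
have f'x x : x \in xs -> f' x = j x by rewrite /f' => ->.
have f'y y : y \in ys -> f' y = f y by rewrite /f' ysP => /andP[/negbTE ->].
have f'V x : x \in guard_vars G ++ free_vars p -> f' x \in V.
  rewrite mem_cat => xs'; rewrite /f'; case: ifP => [/jP/andP[]//|xxs].
  by apply: fV; rewrite ysP xxs.
have [||q [fq vq sq]] := IH i f'.
  by split.
  by move=> x xp; apply: f'V; rewrite mem_cat xp orbT.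
exists (GEx (map f' xs) (map (rename_atom f') G) q); split.
- case: fq => ? ? ? sVq ?; split=> //=.
  + by apply/andP; split=> //; apply: is_guard_rename gd vq.
  + move=> x; rewrite guard_vars_rename !mem_cat => /or3P[|/mapP[y yG ->]|/sVq//].
      by move=> /mapP[y yxs ->]; rewrite f'x //; have /andP[] := jP y yxs.
    by apply: f'V; rewrite mem_cat yG.
  + by split=> // _ /List.in_map_iff[a [<- /GS]]; case: a.
- move=> x /=; rewrite mem_filter mem_cat guard_vars_rename => /andP[nx].
  have h : x \in map f' (guard_vars G ++ free_vars p) -> x \in map f ys.
    move=> /mapP[y]; rewrite mem_cat => yGp ex.
    have yxs : y \notin xs by apply: contra nx => yxs; rewrite ex map_f.
    have yys : y \in ys by rewrite ysP yxs.
    by rewrite ex f'y // map_f.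
  move=> xx; apply: h; rewrite map_cat mem_cat.
  by case/orP: xx => [->//|/vq ->]; rewrite orbT.
- move=> A e.
  have atG (e' : assignment A) : sat_guard e' (map (rename_atom f') G) <->
      sat_guard (fun x => e' (f' x)) G.
    rewrite !sat_guardP; split=> H a.
      by move=> aG; apply/sat_atom_rename/H/List.in_map.
    by move=> /List.in_map_iff[b [<- /H]] ?; apply/sat_atom_rename.
  split=> /= -[e' [re [eG sp]]].
    exists (fun x => if x \in xs then e' (f' x) else e (f x)).
    have ext : {in guard_vars G ++ free_vars p, forall x, e' (f' x) =
        if x \in xs then e' (f' x) else e (f x)}.
      move=> x; rewrite mem_cat => xGp; case xxs: (x \in xs) => //.
      have xys : x \in ys by rewrite ysP xxs.
      rewrite f'y //; have := re (f x); case: mapP => // -[z zxs ez].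
      by have := jP z zxs; rewrite -f'x // -ez map_f // andbF.
    split=> [x|]; first by case xxs: (x \in xs) => //; have := re (f' x); rewrite map_f.
    split.
      apply: sat_guard_ext (proj1 (atG _) eG) => x xG.
      by apply: ext; rewrite mem_cat xG.
    apply: (proj1 (sat_ext _) (proj1 (sq _ _) sp)) => x xp.
    by apply: ext; rewrite mem_cat xp orbT.
  (* [h] transports [e'] back along the renaming; it is well defined because [j] is injective on
     [xs], and keeps [e] on the images of [ys] because [j] avoids them. *)
  have /choice[h hP] : forall z, exists o, if z \in map f' xs
      then forall x, x \in xs -> f' x = z -> o = e' x else o = e z.
    move=> z; case: mapP => [[x xxs ez]|_]; last by exists (e z).
    exists (e' x) => y yxs; rewrite ez !f'x // => /jinj -> //.
  have hx x : x \in xs -> h (f' x) = e' x.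
    by move=> xxs; have := hP (f' x); rewrite map_f // => /(_ x xxs erefl).
  have ext : {in guard_vars G ++ free_vars p, forall x, e' x = h (f' x)}.
    move=> x; rewrite mem_cat => xGp; case xxs: (x \in xs); first by rewrite hx.
    have xys : x \in ys by rewrite ysP xxs.
    have := re x; rewrite xxs => ->; rewrite f'y //.
    have := hP (f x); case: mapP => // -[z zxs ez].
    by have := jP z zxs; rewrite -f'x // -ez map_f // andbF.
  exists h; split=> [z|].
    have := hP z; case: mapP => // -[x xxs ->] _; rewrite hx //.
    by have := re x; rewrite xxs.
  split.
    apply/atG; apply: sat_guard_ext eG => x xG.
    by apply: ext; rewrite mem_cat xG.
  apply/sq; apply: (proj1 (sat_ext _) sp) => x xp.
  by apply: ext; rewrite mem_cat xp orbT.
Qed.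

End Fragment.

(** * Finiteness up to logical equivalence *)

Lemma mem_In (T : eqType) (s : seq T) x : x \in s <-> List.In x s.
Proof.
elim: s => //= y s IH; rewrite inE; split=> [/orP[/eqP->|/IH]|[->|/IH ->]].
- by left.
- by right.
- by rewrite eqxx.
- by rewrite orbT.
Qed.

Lemma In_flatten_map (T T' : Type) (h : T -> seq T') s x y :
  List.In x s -> List.In y (h x) -> List.In y (flatten (map h s)).
Proof.
elim: s => // z s IH [->|/IH H] yh; apply/List.in_or_app; [by left|right].
exact: H.
Qed.

Fixpoint sublists (T : Type) (s : seq T) : seq (seq T) :=
  if s is x :: s' then map (cons x) (sublists s') ++ sublists s' else [:: [::]].

Lemma sublistsP (T : Type) (P : T -> Prop) (s : seq T) :
  exists s', List.In s' (sublists s) /\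
    forall x, List.In x s' <-> List.In x s /\ P x.
Proof.
elim: s => /= [|y s [s' [ss' H]]].
  by exists [::]; split; [left|split=> [|[]]].
case: (pselect (P y)) => [Py|nPy]; [exists (y :: s')|exists s']; split.
- by apply/List.in_or_app; left; apply: List.in_map.
- move=> x /=; rewrite H; split=> [[<-|[]]|[[]]]; auto.
- by apply/List.in_or_app; right.
- move=> x; rewrite H; split=> [[]|[[<-|]]]; auto.
  by move/nPy.
Qed.

Section Finiteness.
Variables (sigma : vocabulary) (g : guarding).
Variables (V : seq nat) (S : seq (symbol sigma)).
Implicit Types (p q : formula sigma) (G : seq (atom sigma)).
Notation fragment := (fragment g V S).

Lemma finitely_many_atoms : exists L : seq (atom sigma), forall a,
  {subset atom_vars a <= V} -> atom_symbols S a -> List.In a L.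
Proof.
have [L LP] : exists L : seq (atom sigma), forall R (xs : (arity R).-tuple nat),
    {subset xs <= V} -> List.In R S -> List.In (Rel xs) L.
  elim: S => [|R0 S' [L LP]]; first by exists [::].
  exists ([seq Rel (map_tuple val t) | t <- enum {: (arity R0).-tuple (seq_sub V)}] ++ L).
  move=> R xs xsV [e|RS']; apply/List.in_or_app; [left|right; exact: LP].
  rewrite e in xs xsV *.
  have [t et] : exists t : (arity R).-tuple (seq_sub V), xs = map_tuple val t.
    pose sx i : seq_sub V := SeqSub (xsV _ (mem_tnth i xs)).
    exists [tuple sx i | i < arity R]; apply: eq_from_tnth => i.
    by rewrite tnth_map tnth_mktuple.
  rewrite et; apply: (List.in_map (fun t => Rel (map_tuple val t))).
  by apply/mem_In; rewrite mem_enum.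
exists ([seq Eq x y | x <- V, y <- V] ++ L) => -[R xs|x y] aV aS;
  apply/List.in_or_app; [by right; apply: LP|left].
have xV : List.In x V by apply/mem_In/aV; rewrite !inE eqxx.
have yV : List.In y V by apply/mem_In/aV; rewrite !inE eqxx orbT.
by apply: (In_flatten_map xV); apply: List.in_map.
Qed.

Definition conjunction (s : seq (formula sigma)) : formula sigma :=
  foldr (@And sigma) Top s.

Lemma sat_conjunction (A : structure sigma) (e : assignment A) s :
  sat e (conjunction s) <-> forall p, List.In p s -> sat e p.
Proof.
elim: s => /= [|q s IH]; first by split.
rewrite IH; split=> [[sq ss] p [<-|/ss]//|H]; split=> [|p ps]; apply: H; auto.
Qed.

Lemma fragment_and i p q : fragment i p -> fragment i q -> fragment i (And p q).
Proof.
move=> [? ? ? sp ?] [? ? ? sq ?]; split=> //=; first exact/andP.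
- exact/andP.
- by rewrite geq_max; apply/andP.
- by move=> x; rewrite mem_cat => /orP[/sp|/sq].
Qed.

Lemma fragment_conjunction i s :
  (forall p, List.In p s -> fragment i p) -> fragment i (conjunction s).
Proof.
elim: s => //= q s IH H; apply: fragment_and; first by apply: H; left.
by apply: IH => p ps; apply: H; right.
Qed.

Lemma free_vars_conjunction (D : seq nat) s :
  (forall p, List.In p s -> {subset free_vars p <= D}) ->
  {subset free_vars (conjunction s) <= D}.
Proof.
elim: s => //= q s IH H x; rewrite mem_cat => /orP[xq|].
  by apply: (H q) xq; left.
by apply: IH => p ps; apply: H; right.
Qed.

Lemma sat_gex_congr (A : structure sigma) (e : assignment A) xs xs' G G' p p' :
  xs =i xs' -> (forall a, List.In a G <-> List.In a G') ->
  (forall e : assignment A, sat e p <-> sat e p') ->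
  sat e (GEx xs G p) -> sat e (GEx xs' G' p').
Proof.
move=> xx' GG' pp' [e' [re [/sat_guardP eG sp]]]; exists e'; split.
  by move=> x; have := re x; rewrite xx'.
by split; [apply/sat_guardP => a /GG'/eG|apply/pp'].
Qed.

Lemma guard_vars_congr G G' : (forall a, List.In a G -> List.In a G') ->
  {subset guard_vars G <= guard_vars G'}.
Proof. by move=> GG' x /guard_varsP[a /GG' aG' xa]; apply/guard_varsP; exists a. Qed.

(** Loose guarding depends only on the set of conjuncts, but atom guarding also on the length of the
    list, hence the equality of lists in that case. *)
Lemma is_guard_congr xs xs' G G' p p' :
  xs =i xs' -> (forall a, List.In a G <-> List.In a G') ->
  (g = AtomGuarding -> G = G') -> {subset free_vars p' <= scope xs G p} ->
  is_guard g xs G p -> is_guard g xs' G' p'.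
Proof.
move=> xx' GG' gG pp'.
have sc : {subset xs' ++ guard_vars G' ++ free_vars p'
              <= xs ++ guard_vars G ++ free_vars p}.
  move=> x; rewrite !mem_cat -xx' => /or3P[->//|xG|xp].
    by rewrite (guard_vars_congr _ xG) ?orbT // => a /GG'.
  by have := pp' x xp; rewrite /scope !mem_cat.
case: g gG => /= gG; first rewrite -gG //.
  by rewrite -gG // in sc; case: (G) sc => [|a []] // sc /allP aP; apply/allP => x /sc/aP.
move=> /allP aP; apply/allP => u; rewrite -xx' => /aP/allP uP.
apply/allP => v /sc/uP/has_atomP[a /GG' aG' av].
by apply/has_atomP; exists a.
Qed.

Definition represents i (L : seq (formula sigma)) p : Prop :=
  exists q, [/\ List.In q L, fragment i q, {subset free_vars q <= free_vars p}
    & forall (A : structure sigma) (e : assignment A), sat e q <-> sat e p].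

(* Members of the fragment are conjunctions of atoms and quantified formulas. *)
Lemma conjunctions_represent i (L : seq (formula sigma)) :
  (forall a, fragment i (Atom a) -> represents i L (Atom a)) ->
  (forall xs G p, fragment i (GEx xs G p) -> represents i L (GEx xs G p)) ->
  forall p, fragment i p -> represents i (map conjunction (sublists L)) p.
Proof.
move=> atP exP p fp.
have [s [sP sE]] : exists s, (forall b, List.In b s ->
      [/\ List.In b L, fragment i b & {subset free_vars b <= free_vars p}]) /\
    forall (A : structure sigma) (e : assignment A),
      (forall b, List.In b s -> sat e b) <-> sat e p.
  elim: p fp => [a|||p _|p IHp q IHq|p _ q _|xs G p _|xs G p _] fp;
    try by case: fp.
  - have [q [qL fq vq sq]] := atP a fp.
    exists [:: q]; split=> [b [<-|[]]|A e] //; rewrite -sq.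
    by split=> [H|? b [<-|[]]] //; apply: H; left.
  - by exists [::].
  - case: fp => /= /andP[p1 p2] /andP[g1 g2]; rewrite geq_max => /andP[r1 r2] sV [S1 S2].
    have [|sp [spP spE]] := IHp.
      by split=> // x xp; apply: sV; rewrite mem_cat xp.
    have [|sq [sqP sqE]] := IHq.
      by split=> // x xp; apply: sV; rewrite mem_cat xp orbT.
    exists (sp ++ sq); split=> [b /List.in_app_iff[/spP|/sqP] [? ? vb]|A e].
    + by split=> // x /vb; rewrite mem_cat => ->.
    + by split=> // x /vb; rewrite mem_cat => ->; rewrite orbT.
    rewrite -spE -sqE; split=> [H|[H1 H2] b /List.in_app_iff[/H1|/H2]//].
    by split=> b bs; apply: H; apply/List.in_or_app; auto.
  - have [q [qL fq vq sq]] := exP _ _ _ fp.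
    exists [:: q]; split=> [b [<-|[]]|A e] //; rewrite -sq.
    by split=> [H|? b [<-|[]]] //; apply: H; left.
have [s' [s'L s'P]] := sublistsP (fun b => List.In b s) L.
exists (conjunction s'); split.
- exact: List.in_map.
- by apply: fragment_conjunction => b /s'P[_ /sP[]].
- by apply: free_vars_conjunction => b /s'P[_ /sP[]].
- move=> A e; rewrite sat_conjunction -sE.
  split=> H b; last by move=> /s'P[_]; apply: H.
  by move=> bs; apply: H; apply/s'P; split=> //; case: (sP b bs).
Qed.

Lemma finitely_many_fragment i : exists L : seq (formula sigma),
  forall p, fragment i p -> represents i L p.
Proof.
have [At AtP] := finitely_many_atoms.
have repA j (L : seq (formula sigma)) a : fragment j (Atom a) ->
    (forall a, List.In a At -> List.In (Atom a) L) -> represents j L (Atom a).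
  by move=> fa LP; exists (Atom a); split=> //; apply: LP; case: fa => *; apply: AtP.
elim: i => [|i [L LP]].
  exists (map conjunction (sublists (map (@Atom sigma) At))).
  apply: conjunctions_represent => [a fa|xs G p []//].
  by apply: repA fa _ => b bA; apply: List.in_map.
(* Singletons are listed apart because an atom guard has to be recovered as the very same list; the
   sublist given by [sublistsP] has the right members only, possibly repeated. *)
pose Gs := sublists At ++ [seq [:: a] | a <- At].
pose Ex := flatten [seq flatten [seq [seq GEx xs G q | q <- L] | G <- Gs] |
                    xs <- sublists V].
have ExP xs G q : List.In xs (sublists V) -> List.In G Gs -> List.In q L ->
    List.In (GEx xs G q) Ex.
  move=> xsV GGs qL; apply: (In_flatten_map xsV); apply: (In_flatten_map GGs).
  exact: List.in_map.
exists (map conjunction (sublists (map (@Atom sigma) At ++ Ex))).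
apply: conjunctions_represent => [a fa|xs G p fp].
  by apply: repA fa _ => b bA; apply/List.in_or_app; left; apply: List.in_map.
case: (fp) => /= pp /andP[gd gp] rk sV [GS pS].
have [|q [qL fq vq sq]] := LP p.
  by split=> // x xp; apply: sV; rewrite !mem_cat xp !orbT.
have [xs' [xs'V xs'P]] := sublistsP (fun x => x \in xs) V.
have xx' : xs =i xs'.
  move=> x; apply/idP/idP => [xxs|/mem_In/xs'P[]//].
  by apply/mem_In/xs'P; split=> //; apply/mem_In/sV; rewrite mem_cat xxs.
have GAt a : List.In a G -> List.In a At.
  move=> aG; apply: AtP (GS a aG) => x xa; apply: sV; rewrite !mem_cat.
  by apply/or3P/Or32/guard_varsP; exists a.
have [G' [G'Gs GG' gG]] : exists G', [/\ List.In G' Gs,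
    forall a, List.In a G <-> List.In a G' & g = AtomGuarding -> G = G'].
  case eg : g gd => gd.
    move: gd GAt; case: (G) => [//|a [|//]] _ GAt; exists [:: a]; split=> //.
    apply/List.in_or_app; right; apply: (List.in_map (fun a => [:: a])).
    by apply: GAt; left.
  have [G' [G'At G'P]] := sublistsP (fun a => List.In a G) At.
  exists G'; split=> //; first by apply/List.in_or_app; left.
  by move=> a; rewrite G'P; split=> [aG|[]//]; split=> //; apply: GAt.
have vE : {subset free_vars (GEx xs' G' q) <= free_vars (GEx xs G p)}.
  move=> x; rewrite !mem_free_vars_ex xx' => /andP[-> /orP[xG|/vq ->]].
    by rewrite (guard_vars_congr _ xG) // => a /GG'.
  by rewrite orbT.
exists (GEx xs' G' q); split=> //.
- by apply/List.in_or_app; right; apply: ExP.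
- case: fq => ppq gq rq sq' Sq; split=> //=.
  + by rewrite gq andbT; apply: is_guard_congr gd => // x /vq/scope_body.
  + move=> x; rewrite !mem_cat -xx' => /or3P[xxs|xG|/sq'//]; apply: sV.
      by rewrite mem_cat xxs.
    by rewrite !mem_cat (guard_vars_congr _ xG) ?orbT // => a /GG'.
  + by split=> // a /GG'/GS.
- move=> A e; split; last by apply: sat_gex_congr => // e'; rewrite sq.
  by apply: sat_gex_congr => [x|a|e']; rewrite ?xx' ?GG' ?sq.
Qed.

(** A type of rank i over the variables [D] becomes a single formula of the same rank, which can
    then be quantified. *)
Lemma fragment_conj i (D : seq nat) (Q : formula sigma -> Prop) : exists p,
  [/\ fragment i p, {subset free_vars p <= D} &
    forall (A : structure sigma) (e : assignment A), sat e p <->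
      forall q, fragment i q -> {subset free_vars q <= D} -> Q q -> sat e q].
Proof.
have [L LP] := finitely_many_fragment i.
(* [Q] need not respect logical equivalence, so members of [L] are chosen for being equivalent to a
   formula satisfying [Q]. *)
have [s [_ sP]] := sublistsP (fun p => [/\ fragment i p, {subset free_vars p <= D}
  & exists q, [/\ fragment i q, {subset free_vars q <= D}, Q q &
    forall (A : structure sigma) (e : assignment A), sat e p <-> sat e q]]) L.
exists (conjunction s); split.
- by apply: fragment_conjunction => p /sP[_ []].
- by apply: free_vars_conjunction => p /sP[_ []].
- move=> A e; rewrite sat_conjunction; split=> [H q fq vq Qq|H p /sP[_ [fp vp]]].
    have [p [pL fp vp sp]] := LP q fq.
    apply/sp/H/sP; split=> //; split=> //; first by move=> x /vp/vq.
    by exists q.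
  by move=> [q [fq vq Qq ->]]; apply: H.
Qed.

End Finiteness.

(** * Products and amalgams *)

Definition assign_map (A B : Type) (h : A -> B) (e : nat -> option A) :
  nat -> option B := fun x => omap h (e x).

Definition assign_pair (A B : Type) (e1 : nat -> option A) (e2 : nat -> option B) :
  nat -> option (A * B) :=
  fun x => if e1 x is Some a then omap (pair a) (e2 x) else None.

Lemma assign_map_comp (A B : Type) (h : A -> B) (e : nat -> option A)
    (r : nat -> option nat) :
  assign_map h e \op r = assign_map h (e \op r).
Proof. by apply/funext => x; rewrite /assign_map /pcomp; case: (r x). Qed.

Lemma assign_pair_comp (A B : Type) (e1 : nat -> option A) (e2 : nat -> option B)
    (r : nat -> option nat) :
  assign_pair e1 e2 \op r = assign_pair (e1 \op r) (e2 \op r).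
Proof. by apply/funext => x; rewrite /assign_pair /pcomp; case: (r x). Qed.

Lemma map_assign_pair (A B : Type) (e1 : nat -> option A) (e2 : nat -> option B)
    (xs : seq nat) (v : seq (A * B)) :
  map (assign_pair e1 e2) xs = map Some v <->
  map e1 xs = map Some (map fst v) /\ map e2 xs = map Some (map snd v).
Proof.
elim: xs v => [|x xs IH] [|[a b] v]; try by split=> // -[].
rewrite /= /assign_pair; split=> [[ex /IH[-> ->]]|[[-> e1s] [-> e2s]]].
  by case: (e1 x) ex => [a'|//]; case: (e2 x) => [b'|//] [-> ->].
by congr cons; apply/IH.
Qed.

Section Product.
Variables (sigma : vocabulary) (A B : structure sigma).

Definition product : structure sigma := @Structure sigma (A * B)%type
  (fun R v => interp (map_tuple fst v) /\ interp (map_tuple snd v)).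

Lemma snd_hom : is_hom (snd : product -> B).
Proof. by move=> R v []. Qed.

Lemma sat_atom_product (e1 : assignment A) (e2 : assignment B) a :
  sat_atom (assign_pair e1 e2 : assignment product) a <->
  sat_atom e1 a /\ sat_atom e2 a.
Proof.
case: a => [R xs|x y] /=.
- split=> [[v /map_assign_pair[ev1 ev2] [R1 R2]]|[[v1 ev1 R1] [v2 ev2 R2]]].
    by split; [exists (map_tuple fst v)|exists (map_tuple snd v)].
  have e1' : map_tuple fst [tuple of zip v1 v2] = v1.
    by apply/val_inj; rewrite /= -/(unzip1 _) unzip1_zip // !size_tuple.
  have e2' : map_tuple snd [tuple of zip v1 v2] = v2.
    by apply/val_inj; rewrite /= -/(unzip2 _) unzip2_zip // !size_tuple.
  have R1' : interp (map_tuple fst [tuple of zip v1 v2]) by rewrite e1'.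
  have R2' : interp (map_tuple snd [tuple of zip v1 v2]) by rewrite e2'.
  exists [tuple of zip v1 v2] => //.
  apply/map_assign_pair; rewrite ev1 ev2; split; congr map.
    by rewrite -[LHS](congr1 val e1').
  by rewrite -[LHS](congr1 val e2').
- rewrite /assign_pair; split.
    move=> [[a b]]; case: (e1 x) => [?|//]; case: (e2 x) => [?|//] [-> ->].
    case: (e1 y) => [?|//]; case: (e2 y) => [?|//] [-> ->].
    by split; [exists a|exists b].
  by move=> [[a -> ->] [b -> ->]]; exists (a, b).
Qed.

Lemma sat_product (e1 : assignment A) (e2 : assignment B) p :
  primitive_positive p ->
  sat (assign_pair e1 e2 : assignment product) p <-> sat e1 p /\ sat e2 p.
Proof.
elim: p e1 e2 => //= [a|p IHp q IHq|xs G p IH] e1 e2.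
- by move=> _; apply: sat_atom_product.
- by move=> /andP[pp pq]; rewrite IHp // IHq //; tauto.
- move=> pp.
  have atG (e1' : assignment A) (e2' : assignment B) :
      sat_guard (assign_pair e1' e2' : assignment product) G <->
      sat_guard e1' G /\ sat_guard e2' G.
    rewrite !sat_guardP; split=> [H|[H1 H2] a aG]; last by apply/sat_atom_product; auto.
    by split=> a /H/sat_atom_product[].
  split=> [[e [re [eG sp]]]|[[e1' [re1 [eG1 sp1]]] [e2' [re2 [eG2 sp2]]]]].
    (* Outside [xs] the pair is undefined as soon as one component is, so there the projections of
       [e] could lose values of [e1] and [e2]. *)
    pose e1' x := if x \in xs then omap fst (e x) else e1 x.
    pose e2' x := if x \in xs then omap snd (e x) else e2 x.
    have ee : e = assign_pair e1' e2'.
      apply/funext => x; have := re x; rewrite /e1' /e2' /assign_pair.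
      by case: (x \in xs) => //; case: (e x) => // -[].
    move: eG sp; rewrite ee => /atG[eG1 eG2] /(IH _ _ pp)[sp1 sp2].
    split; [exists e1'|exists e2']; split=> // x; have := re x;
      rewrite /e1' /e2'; case: (x \in xs) => //; by case: (e x).
  exists (assign_pair e1' e2'); split; last by rewrite atG IH.
  move=> x; have := re1 x; have := re2 x; rewrite /assign_pair.
  by case: (x \in xs) => [|-> ->] //; case: (e1' x) => //; case: (e2' x).
Qed.

End Product.

Section Gluing.
Variables (sigma : vocabulary) (g : guarding).
Variables (V : seq nat) (S : seq (symbol sigma)) (i : nat).
Notation fragment := (fragment g V S).

(* [Y] is covered by partial copies of [M true] and [M false] overlapping in
   the tuple [m]. *)
Lemma sat_covered (Y : structure sigma) (M : bool -> structure sigma)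
    (m : forall s, assignment (M s)) (pr : forall s, Y -> option (M s)) :
  (forall R (v : (arity R).-tuple Y), interp v ->
     exists s (u : (arity R).-tuple (M s)), map (pr s) v = map Some u /\ interp u) ->
  (forall y, exists s, isSome (pr s y)) ->
  (forall y, (forall s, isSome (pr s y)) -> exists z, forall s, pr s y = m s z) ->
  (forall r p s s', fragment i p -> sat (m s \op r) p -> sat (m s' \op r) p) ->
  forall p (e : assignment Y) s, fragment i p -> sat e p ->
    {in free_vars p, forall x, isSome (obind (pr s) (e x))} ->
    sat (fun x => obind (pr s) (e x)) p.
Proof.
move=> facts cover overlap agree.
pose side s (e : assignment Y) : assignment (M s) := fun x => obind (pr s) (e x).
(* A tuple visible on both sides lies in the overlap, where [agree] applies. *)
have transfer p (e : assignment Y) s t : fragment i p ->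
    {in free_vars p, forall x, isSome (side s e x)} ->
    {in free_vars p, forall x, isSome (side t e x)} ->
    sat (side t e) p -> sat (side s e) p.
  move=> fp; case: (eqVneq s t) => [->//|nst] ps pt.
  have [r rP] : exists r : nat -> option nat, forall x, x \in free_vars p ->
      forall s, side s e x = (m s \op r) x.
    have /choice[r rP] : forall x, exists o : option nat, x \in free_vars p ->
        forall s, side s e x = obind (m s) o.
      move=> x; case xp: (x \in free_vars p); last by exists None.
      have := ps x xp; have := pt x xp; rewrite /side; case: (e x) => //= y yt ys.
      have [s'|z zP] := overlap y.
        have : s' \in [:: s; t] by case: s' s t nst {ps pt ys yt} => [] [] [].
        by rewrite !inE => /orP[]/eqP->.
      by exists (Some z).
    by exists r.
  have [_ toS] := sat_ext (e := side s e) (e' := m s \op r) (fun x xp => rP x xp s).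
  have [toT _] := sat_ext (e := side t e) (e' := m t \op r) (fun x xp => rP x xp t).
  by move=> sp; exact: toS (agree r p t s fp (toT sp)).
have atoms a (e : assignment Y) : sat_atom e a -> exists s,
    {in atom_vars a, forall x, isSome (side s e x)} /\ sat_atom (side s e) a.
  case: a => [R xs|x y] /= [v ev]; last first.
    move=> ev'; have [s sv] := cover v; exists s; rewrite /side; split.
      by move=> z; rewrite !inE => /orP[]/eqP->; rewrite ?ev ?ev'.
    by case ep: (pr s v) sv => [c|//] _; exists c; rewrite ?ev ?ev'.
  move=> /facts[s [u [eu Ru]]]; exists s.
  have es : map (side s e) xs = map Some u.
    transitivity (map (obind (pr s)) (map e xs)); first by rewrite -map_comp.
    by rewrite ev -map_comp -eu.
  by split=> [x|]; [apply: map_Some_def es|exists u].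
elim=> [a|||p _|p IHp q IHq|p _ q _|xs G p IH|xs G p _] e s fp; try by case: fp.
- move=> sa eS; have [t [et st]] := atoms a e sa.
  exact: (transfer _ _ _ _ fp eS et st).
- case: fp => /= /andP[p1 p2] /andP[g1 g2]; rewrite geq_max => /andP[r1 r2] sV [S1 S2].
  move=> [sp sq] eS; split; [apply: IHp|apply: IHq] => //.
  + by split=> // x xp; apply: sV; rewrite mem_cat xp.
  + by move=> x xp; apply: eS; rewrite mem_cat xp.
  + by split=> // x xp; apply: sV; rewrite mem_cat xp orbT.
  + by move=> x xp; apply: eS; rewrite mem_cat xp orbT.
case: (fp) => /= pp /andP[gd gp] rk sV [GS pS] [e' [re [eG sp]]] eS.
have fp' : fragment i p.
  split=> //; first by apply: ltnW.
  by move=> x xp; apply: sV; rewrite !mem_cat xp !orbT.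
have e'e x : x \notin xs -> e' x = e x by move=> /negbTE xxs; have := re x; rewrite xxs.
have {}eS : {in free_vars (GEx xs G p), forall x, isSome (side s e' x)}.
  move=> x xys; have := eS x xys; move: xys; rewrite mem_free_vars_ex => /andP[xxs _].
  by rewrite /side e'e.
(* The guard forces the whole scope on one side. *)
have [t tP] : exists t, {in scope xs G p, forall x, isSome (side t e' x)}.
  apply: contrapT => nt.
  have miss t : exists2 x, x \in scope xs G p & ~ isSome (side t e' x).
    apply: contrapT => nx; apply: nt; exists t => x xs'.
    by apply: contrapT => nxt; apply: nx; exists x.
  have [v vs nv] := miss s; have [v' v's nv'] := miss (~~ s).
  have [vxs|] := boolP (v \in xs); last first.
    by move=> vxs; case: nv; apply: eS; move: vs; rewrite mem_scope (negbTE vxs).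
  have [a [aG va v'a]] := is_guard_loose gd vxs v's.
  have [t [ta _]] := atoms a e' (proj1 (sat_guardP _ _) eG a aG).
  by case: (eqVneq t s) => [ts|]; [case: nv|case: t s ta nv' {eS nv miss} => [] []]; rewrite -?ts; auto.
(* The formula is evaluated on the side [t] containing the scope, then moved as a whole to [s]: its
   free variables are visible on both sides. *)
have st : sat (side t e') (GEx xs G p).
  exists (side t e'); split=> [x|].
    by case: ifP => // xxs; apply: tP; rewrite mem_scope xxs.
  split; last by apply: IH => // x xp; apply/tP/scope_body.
  apply/sat_guardP => a aG.
  have aF : fragment i (Atom a).
    split=> //=; last exact: GS.
    move=> x xa; apply: sV; rewrite !mem_cat; apply/or3P/Or32/guard_varsP.
    by exists a.
  have [t' [ta' sa]] := atoms a e' (proj1 (sat_guardP _ _) eG a aG).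
  by apply: (transfer (Atom a) e' t t') => // x xa; apply: tP; apply: scope_atom xa.
have st' : sat (side s e') (GEx xs G p).
  by apply: (transfer _ e' s t) => // x xys; apply/tP/scope_free.
apply: (proj1 (sat_ext (e := side s e') _) st') => x.
by rewrite mem_free_vars_ex => /andP[xxs _]; rewrite /side e'e.
Qed.

(** Agreement on equalities makes the identification of the two tuples well defined. Agreement on
    the rest of the fragment keeps the facts of [X] from making new formulas of rank i true of
    tuples of [C]. *)
Lemma amalgamation (X C : structure sigma) (x0 : assignment X) (c0 : assignment C) :
  (forall z, isSome (x0 z) -> z \in V) -> (forall z, isSome (c0 z) -> z \in V) ->
  (forall r p, fragment i p -> sat (x0 \op r) p <-> sat (c0 \op r) p) ->
  exists (Y : structure sigma) (h : X -> Y) (k : C -> Y),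
    [/\ is_hom h, is_hom k, assign_map k c0 = assign_map h x0
      & forall (e : assignment C) p, fragment i p ->
          sat (assign_map k e) p -> sat e p].
Proof.
move=> xV cV agree.
have agreeq z z' : z \in V -> z' \in V ->
    sat_atom x0 (Eq z z') <-> sat_atom c0 (Eq z z').
  move=> zV z'V; apply: (agree Some (Atom (Eq z z'))); split=> //= x.
  by rewrite !inE => /orP[]/eqP->.
have xc z z' a : x0 z = Some a -> x0 z' = Some a ->
    exists2 c, c0 z = Some c & c0 z' = Some c.
  move=> ez ez'; apply/agreeq; first by apply: xV; rewrite ez.
    by apply: xV; rewrite ez'.
  by exists a.
have cx z z' c : c0 z = Some c -> c0 z' = Some c ->
    exists2 a, x0 z = Some a & x0 z' = Some a.
  move=> ez ez'; apply/agreeq; first by apply: cV; rewrite ez.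
    by apply: cV; rewrite ez'.
  by exists c.
pose M (s : bool) := if s then X else C.
pose m : forall s, assignment (M s) := fun s => if s as s return assignment (M s) then x0 else c0.
pose prX (y : X + C) : option X := if y is inl a then Some a else None.
(* An element of [X] named by [x0] also stands for the element of [C] with the same name. A second
   copy [inr c] of the latter remains in [Y]; it is harmless, as it projects to [c]. *)
pose prC (y : X + C) : option C := match y with
  | inl a => if pselect (exists z, x0 z = Some a) is left h then c0 (sval (cid h)) else None
  | inr c => Some c end.
pose pr : forall s, X + C -> option (M s) :=
  fun s => if s as s return X + C -> option (M s) then prX else prC.
pose Y : structure sigma := @Structure sigma (X + C)%type
  (fun R v => exists s (u : (arity R).-tuple (M s)), map (pr s) v = map Some u /\ interp u).
have prCx z a : x0 z = Some a -> prC (inl a) = c0 z.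
  move=> ez /=; case: pselect => [h|[]]; last by exists z.
  by case: (cid h) => z' /= ez'; have [c -> ->] := xc _ _ _ ez ez'.
have /choice[k kP] : forall c, exists y : Y, prC y = Some c /\
    forall z, c0 z = Some c -> omap inl (x0 z) = Some y.
  move=> c; case: (pselect (exists z, c0 z = Some c)) => [[z ez]|nz].
    have [a xz _] := cx _ _ _ ez ez; exists (inl a); rewrite (prCx z) //; split=> //.
    by move=> z' ez'; have [a' xz' xz2] := cx _ _ _ ez' ez; rewrite xz' -xz2 xz.
  by exists (inr c); split=> // z ez; case: nz; exists z.
exists Y, (inl : X -> Y), k; split.
- by move=> R v Rv; exists true, v; split=> //=; rewrite -map_comp.
- move=> R v Rv; exists false, v; split=> //=; rewrite -map_comp.
  by apply: eq_map => c /=; case: (kP c).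
- apply/funext => z; rewrite /assign_map; case ez: (c0 z) => [c|] /=.
    by have [_ /(_ z ez) ->] := kP c.
  by case xz: (x0 z) => [a|//]; have [c] := xc _ _ _ xz xz; rewrite ez.
- move=> e p fp sp.
  have ek : (fun x => obind (pr false) (assign_map k e x)) = e.
    apply/funext => x; rewrite /assign_map; case: (e x) => //= c.
    by case: (kP c).
  suff: sat (fun x => obind (pr false) (assign_map k e x)) p by rewrite ek.
  apply: (@sat_covered Y M m pr) => //.
  + by case=> [a|c]; [exists true|exists false].
  + case=> [a|c] H; last by have := H true.
    have := H false; rewrite /=; case: pselect => // -[z ez] _.
    by exists z => -[]; [exact: esym ez|exact: prCx ez].
  + by move=> r q [] [] fq //= /(agree r q fq).
  + move=> x xp; change (isSome ((fun x => obind (pr false) (assign_map k e x)) x)).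
    rewrite ek.
    have := pp_sat_def _ sp xp; rewrite /assign_map; case: (e x) => //= H.
    by apply: H; case: fp.
Qed.
End Gluing.

(** * The frame of typed tuples *)

Section Types.
Variables (sigma : vocabulary) (g : guarding).
Variables (V : seq nat) (S : seq (symbol sigma)) (k : nat).
Hypothesis uV : uniq V.
Notation fragment := (fragment g V S).
Implicit Types (A B C X Y : structure sigma) (r s : nat -> option nat).

(** Worlds name elements by arbitrary numbers, and links must carry atoms over all of them, so a
    type also contains the atoms whose variables lie outside [V]. *)
Definition basic (p : formula sigma) : Prop :=
  fragment k p \/ exists2 a, p = Atom a & atom_symbols S a.

Lemma basic_pp p : basic p -> primitive_positive p.
Proof. by case=> [[]|[a ->]]. Qed.

Lemma fragment_leq i j p : i <= j -> fragment i p -> fragment j p.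
Proof. by move=> ij [? ? ri ? ?]; split=> //; apply: leq_trans ij. Qed.

Lemma fragment_basic i p : i <= k -> fragment i p -> basic p.
Proof. by move=> ik fp; left; apply: fragment_leq fp. Qed.

Lemma fragment_def x : x \in V -> fragment 0 (Atom (Eq x x)).
Proof. by move=> xV; split=> //= y; rewrite !inE orbb => /eqP->. Qed.

Lemma sat_def A (e : assignment A) x : isSome (e x) <-> sat_atom e (Eq x x).
Proof. by split=> /= [|[a ->]//]; case: (e x) => // a _; exists a. Qed.

(* The new type is that of a product, which realises exactly the formulas
   common to its factors; amalgamation provides the factor realising nothing
   more than [c] at rank [i], and [X] and [B] keep the type over the free
   variables and the type in [B] small. *)
Lemma type_extension C X B (c : assignment C) (x0 : assignment X)
    (b : assignment B) xs G q i (ys := free_vars (GEx xs G q)) :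
  i < k -> is_guard g xs G q ->
  {subset xs ++ guard_vars G ++ free_vars q <= V} ->
  (forall a, List.In a G -> atom_symbols S a) ->
  prestr (scope xs G q) c = c -> prestr ys x0 = x0 -> prestr ys b = b ->
  sat_guard c G ->
  (forall r p, fragment i.+1 p ->
     sat (prestr ys c \op r) p <-> sat (x0 \op r) p) ->
  (forall r p, basic p -> sat (x0 \op r) p -> sat (b \op r) p) ->
  (forall z, isSome (b z) = isSome (x0 z)) ->
  exists Y (y : assignment Y) (b' : assignment B),
    [/\ (forall z, isSome (b' z) = isSome (y z)) /\ prestr ys b' = b,
        forall r p, basic p -> sat (prestr ys y \op r) p <-> sat (x0 \op r) p,
        forall r p, fragment i p -> sat (y \op r) p <-> sat (c \op r) p
      & forall r p, basic p -> sat (y \op r) p -> sat (b' \op r) p].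
Proof.
move=> ik gd scV GS cD x0D bD cG cx0 x0b domb.
have cDin z : isSome (c z) -> z \in scope xs G q.
  by rewrite -cD /prestr; case: ifP.
have ysV : {subset ys <= V} by move=> z /scope_free/scV.
have [pe [fpe vpe spe]] := fragment_conj g V S i (scope xs G q) (fun p => sat c p).
have cpe : sat c pe by apply/spe.
(* The rank budget: the quantified conjunction has rank at most i.+1, at which [c] and [x0] agree
   over [ys], and it passes from [x0] to [b] since i < k. This yields the witnesses [z1] in [X] and
   [b1] in [B]. *)
have fex : fragment i.+1 (GEx xs G pe).
  case: (fpe) => ppe gpe rpe sVpe Spe; split=> //=.
    by rewrite gpe andbT; apply: is_guard_congr gd.
  move=> z; rewrite !mem_cat => /or3P[zxs|zG|/sVpe//]; apply: scV.
    by rewrite mem_cat zxs.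
  by rewrite !mem_cat zG orbT.
have cex : sat (prestr ys c) (GEx xs G pe).
  exists c; split=> // z; case: ifP => zxs.
    exact: sat_guard_def cG (is_guard_quantified gd zxs).
  rewrite /prestr; case: ifP => // zys; case cz: (c z) => [a|//].
  by have := cDin z; rewrite cz mem_scope zxs => /(_ isT); rewrite -/ys zys.
have x0ex : sat x0 (GEx xs G pe) by apply: (proj1 (cx0 Some _ fex)).
have bex : sat b (GEx xs G pe) by apply: (x0b Some) => //; apply: fragment_basic fex.
have [z1 [rz1 [_ z1pe]]] := x0ex; have [b1 [rb1 [_ b1pe]]] := bex.
(* [pe] speaks of the variables of the scope as they are, types of all their renamings. Substitution
   within the fragment turns a renamed formula into a conjunct of [pe]. *)
have keep A (e : assignment A) : sat e pe -> forall r p, fragment i p ->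
    sat (c \op r) p -> sat (e \op r) p.
  move=> epe r p fp cp; have ppp : primitive_positive p by case: fp.
  have rdef x : x \in free_vars p -> exists2 z, r x = Some z & z \in scope xs G q.
    move=> xp; have := pp_sat_def ppp cp xp; rewrite /pcomp.
    by case: (r x) => //= z /cDin; exists z.
  pose f x := odflt 0 (r x).
  have rf A' (e' : assignment A') : {in free_vars p, (e' \op r) =1 fun x => e' (f x)}.
    by move=> x /rdef[z rz _]; rewrite /pcomp /f rz.
  have [|p' [fp' vp' sp']] := fragment_subst uV fp (f := f).
    by move=> x /rdef[z rz zs]; rewrite /f rz; apply: scV.
  apply/(sat_ext (@rf _ e))/sp'; apply: (proj1 (spe _ _) epe) => //.
    by move=> x /vp'/mapP[y /rdef[z rz zs] ->]; rewrite /f rz.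
  by apply/sp'; apply/(sat_ext (@rf _ c)).
have keepdef A (e : assignment A) z : sat e pe -> isSome (c z) -> isSome (e z).
  move=> epe cz; apply/sat_def; apply: (keep _ _ epe Some (Atom (Eq z z))).
    by apply: fragment_leq (fragment_def (scV z (cDin z cz))).
  exact/sat_def.
have domx0 z : z \in ys -> isSome (c z) = isSome (x0 z).
  move=> zys; rewrite -(prestr_in c zys).
  have H : sat_atom (prestr ys c) (Eq z z) <-> sat_atom x0 (Eq z z).
    exact: cx0 Some _ (fragment_leq (leq0n _) (fragment_def (ysV z zys))).
  by apply/idP/idP => /sat_def/H/sat_def.
have notys A (e e' : assignment A) z : reassigns xs e e' -> z \in ys -> e' z = e z.
  by move=> re; rewrite mem_free_vars_ex => /andP[/negbTE zxs _]; have := re z; rewrite zxs.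
have supp A (e : assignment A) z : prestr ys e = e -> isSome (e z) -> z \in V.
  by move=> <-; rewrite /prestr; case: ifP => // /ysV.
(* The overlap is the tuple over the free variables, where agreement at rank i.+1 entails agreement
   at rank i. *)
have [||r p fp|Y0 [h [l [hh lh hl reflect]]]] :=
    @amalgamation _ g V S i X C x0 (prestr ys c).
- by move=> z; apply: supp.
- by move=> z; rewrite /prestr; case: ifP => // /ysV.
- by rewrite cx0 //; apply: fragment_leq fp.
pose Y := product (product Y0 X) B.
pose y : assignment Y := assign_pair (assign_pair (assign_map l c : assignment Y0) z1) b1.
have ydef z : isSome (c z) = isSome (y z).
  rewrite /y /assign_pair /assign_map.
  case cz: (c z) => [a|//].
  have : isSome (z1 z) by apply: keepdef z1pe _; rewrite cz.
  have : isSome (b1 z) by apply: keepdef b1pe _; rewrite cz.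
  by case: (b1 z) => // ? _; case: (z1 z).
have yys : prestr ys y =
    assign_pair (assign_pair (assign_map l (prestr ys c)) x0) b.
  apply/funext => z; rewrite -x0D -bD /prestr /assign_pair /assign_map.
  case: ifP => // zys.
  by rewrite /y /assign_pair /assign_map (notys _ _ _ _ rz1) // (notys _ _ _ _ rb1).
exists Y, y, (assign_map snd y); split.
- split=> [z|]; first by rewrite /assign_map; case: (y z).
  apply/funext => z; rewrite -[in RHS]bD /prestr; case: ifP => // zys.
  have := domx0 z zys; rewrite ydef -domb -(notys _ _ _ _ rb1 zys).
  rewrite /assign_map /y /assign_pair /assign_map.
  by case: (c z) => [a|] /=; case: (z1 z) => [?|]; case: (b1 z).
(* By [hl] the formulas true of [x0] reach [Y0] along [h], and by [x0b] they hold in [B]; the factor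
   [X] excludes all others. *)
- move=> r p bp; have ppp := basic_pp bp.
  rewrite yys !assign_pair_comp !sat_product //; split=> [[[]]//|x0p].
  split; last exact: x0b.
  split=> //; rewrite hl assign_map_comp; apply: sat_hom => //.
  exact: primitive_positive_existential.
- move=> r p fp; have ppp : primitive_positive p by case: fp.
  rewrite /y !assign_pair_comp !sat_product // assign_map_comp.
  split=> [[[/reflect cp _] _]|cp]; first exact: cp.
  split; last exact: keep b1pe _ _ fp cp.
  split; last exact: keep z1pe _ _ fp cp.
  by apply: sat_hom => //; apply: primitive_positive_existential.
- move=> r p /basic_pp/primitive_positive_existential epp yp.
  rewrite assign_map_comp.
  exact: (@sat_hom _ Y B snd (y \op r) p (@snd_hom _ _ _) epp yp).
Qed.

(** Pairing formulas with a renaming [r] reads off the type of every subtuple and rearrangement of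
    [c], although the variables of a formula are confined to [V]. *)
Definition type_of C (c : assignment C) r p : Prop := basic p /\ sat (c \op r) p.

Definition realizable B (x : assignment B)
    (t : (nat -> option nat) -> formula sigma -> Prop) : Prop :=
  exists C (c : assignment C), [/\ t = type_of c,
    forall z, isSome (x z) = isSome (c z) & forall r p, t r p -> sat (x \op r) p].

(* A tuple of [B] together with a smaller type, that of a tuple of some other
   structure. *)
Record typed_tuple B := TypedTuple {
  elements : assignment B;
  theory : (nat -> option nat) -> formula sigma -> Prop;
  theory_realizable : realizable elements theory }.

Definition typed_eq B (w : typed_tuple B) x y : Prop := theory w Some (Atom (Eq x y)).

Definition typed_rel B (w : typed_tuple B) R (zs : (arity R).-tuple nat) : Prop :=
  theory w Some (Atom (Rel zs)).

(** Links preserve the full type of the shared tuple, of rank k; the decreasing rank i appears only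
    in the comparison between two frames. *)
Definition typed_link B (w : typed_tuple B) r (w' : typed_tuple B) r' : Prop :=
  elements w \op r = elements w' \op r' /\
  forall s p, theory w (r \op s) p <-> theory w' (r' \op s) p.

Lemma basic_atom a : basic (Atom a) <-> atom_symbols S a.
Proof.
split=> [[[_ _ _ _]//|[b [->]]//]|aS].
by right; exists a.
Qed.

Lemma typed_atom B (w : typed_tuple B) r a :
  local_atom (typed_eq w) (@typed_rel B w) r a <-> theory w r (Atom a).
Proof.
have [C [c [tc _ _]]] := theory_realizable w.
have -> : typed_eq w = names_eq c.
  apply/funext => x; apply/funext => y; apply/propext.
  by rewrite /typed_eq tc /type_of basic_atom; split=> [[]|].
have -> : @typed_rel B w = @names_rel sigma S C c.
  apply: functional_extensionality_dep => R; apply/funext => zs; apply/propext.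
  by rewrite /typed_rel tc /type_of basic_atom.
by rewrite local_atomE tc /type_of basic_atom.
Qed.

Lemma typed_eq_trans B (w : typed_tuple B) x y z :
  typed_eq w x y -> typed_eq w y z -> typed_eq w x z.
Proof.
have [C [c [tc _ _]]] := theory_realizable w; rewrite /typed_eq tc.
move=> [_ xy] [_ yz]; split; first exact/basic_atom.
exact: names_eq_trans xy yz.
Qed.

(** This relies on the equal domains in [realizable]: a number that is not a name for the type is
    undefined in [B] as well. *)
Lemma typed_same_value B (w : typed_tuple B) r r' :
  (forall x, same_value (typed_eq w) (r x) (r' x)) -> typed_link w r w r'.
Proof.
have [C [c [tc xc xsat]]] := theory_realizable w.
move=> rr'.
have crr' : c \op r = c \op r'.
  apply: same_value_comp => x.
  rewrite (_ : names_eq c = typed_eq w) //; apply/funext => y; apply/funext => z.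
  by apply/propext; rewrite /typed_eq tc /type_of basic_atom; split=> [|[]].
have xrr' : elements w \op r = elements w \op r'.
  apply: same_value_comp => x; case: (rr' x) => [[a [b [ra rb ab]]]|[na na']].
    by left; exists a, b; split=> //; apply: (xsat _ _ ab).
  have wa a : names_eq (elements w) a a -> typed_eq w a a.
    move=> /sat_def xa; rewrite /typed_eq tc; split; first exact/basic_atom.
    by apply/sat_def; rewrite pcompSome -xc.
  by right; split=> a /wa; [apply: na|apply: na'].
by split=> // s p; rewrite tc /type_of !pcompA crr'.
Qed.

Definition typed_frame B : frame sigma.
Proof.
refine (@Frame sigma (typed_tuple B) (@typed_eq B) (@typed_rel B) (@typed_link B)
  _ _ _ _ _ _ _ _).
- move=> w x y; have [C [c [tc _ _]]] := theory_realizable w; rewrite /typed_eq tc.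
  by move=> [_ [v cx cy]]; split; [exact/basic_atom|exists v].
- exact: typed_eq_trans.
- move=> w R zs z; have [C [c [tc _ _]]] := theory_realizable w.
  rewrite /typed_rel /typed_eq tc => -[/basic_atom RS sR] zzs.
  split; first exact/basic_atom.
  by apply: (@names_rel_name _ S _ c R zs).
- exact: typed_same_value.
- by move=> w r w' r' [ex et]; split=> // s p; rewrite et.
- move=> w r w' r' w'' r'' [e et] [e' et']; split=> [|s p]; first by rewrite e.
  by rewrite et.
- move=> w r w' r' u [ex et]; split=> [|s p]; first by rewrite !pcompA ex.
  by rewrite -!pcompA et.
- move=> w r w' r' a [_ et] /typed_atom ta; apply/typed_atom.
  exact: (proj1 (et Some _) ta).
Defined.

(** One round of the game. The link from [w] to [w'] turns the agreement of [w] and [v] into one of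
    [w'] and [v] over the free variables, as [type_extension] requires; its result is the new bag
    [v']. *)
Lemma typed_step A B (w : typed_tuple A) r (v : typed_tuple B) r2 xs G q i
    (w' : typed_tuple A) r' (ys := free_vars (GEx xs G q)) :
  i < k -> is_guard g xs G q ->
  {subset xs ++ guard_vars G ++ free_vars q <= V} ->
  (forall a, List.In a G -> atom_symbols S a) ->
  (forall s p, fragment i.+1 p ->
     theory w (prestr ys r \op s) p <-> theory v (prestr ys r2 \op s) p) ->
  typed_link w (prestr ys r) w' (prestr ys r') ->
  (forall a, List.In a G -> theory w' r' (Atom a)) ->
  exists v' : typed_tuple B,
    [/\ typed_link v (prestr ys r2) v' (prestr ys Some),
        forall a, List.In a G -> theory v' Some (Atom a)
      & forall s p, fragment i p ->
          theory w' (prestr (scope xs G q) r' \op s) p <-> theory v' s p].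
Proof.
move=> ik gd scV GS wv [_ ww'] wG; set D := scope xs G q.
have [C [cw [tw _ _]]] := theory_realizable w'.
have [X [cx [tv domv vsat]]] := theory_realizable v.
have ysD : {subset ys <= D} by apply: scope_free.
(* The realisation of Spoiler's type is renamed by [r'] to the variables of the scope, so Duplicator
   can answer with the naming [Some]. *)
pose c := prestr D (cw \op r').
have cys : prestr ys c = cw \op prestr ys r' by rewrite /c prestr_sub // pcomp_restr.
have cG a : List.In a G -> sat_atom c a.
  move=> aG; have := wG a aG; rewrite tw => -[_ /=]; apply: sat_atom_ext => x xa.
  by rewrite /c prestr_in //; apply: scope_atom xa.
have [] := @type_extension C X B c (prestr ys (cx \op r2))
  (prestr ys (elements v \op r2)) xs G q i ik gd scV GS.
- by rewrite /c prestr_sub.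
- by rewrite prestr_sub.
- by rewrite prestr_sub.
- exact/sat_guardP.
- move=> s p fp; have bp := fragment_basic ik fp.
  have := wv s p fp; rewrite ww' tw tv /type_of !pcompA -cys -pcomp_restr.
  by move=> H; split=> h; have [] := H; [move=> /(_ (conj bp h))[]|move=> _ /(_ (conj bp h))[]].
- move=> s p bp sp; rewrite -pcomp_restr -pcompA; apply: vsat.
  by rewrite tv; split=> //; rewrite pcompA pcomp_restr.
- move=> z; rewrite /prestr; case: ifP => // _; rewrite /pcomp.
  by case: (r2 z) => //= z'.
move=> Y [y [b' [[domb' b'ys] ysat yi b'sat]]].
have real : realizable b' (type_of y).
  by exists Y, y; split=> // s p [bp yp]; apply: b'sat.
have third s p : fragment i p ->
    theory w' (prestr D r' \op s) p <-> type_of y s p.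
  move=> fp; rewrite tw /type_of pcompA pcomp_restr -/c.
  by split=> -[bp /(yi s p fp)].
exists (TypedTuple real); split=> //=.
- split=> [|s p] /=; first by rewrite !pcomp_restr -b'ys.
  rewrite tv /type_of !pcompA !pcomp_restr pcompSome.
  by split=> -[bp] /(ysat s p bp).
- move=> a aG; have fa : fragment i (Atom a).
    split=> //=; last exact: GS.
    by move=> x xa; apply/scV/(scope_atom _ _ aG).
  apply/(third Some _ fa); rewrite tw; split; first exact/basic_atom/GS.
  by rewrite pcompSome pcomp_restr; apply: cG.
Qed.

Lemma theory_restr B (w : typed_tuple B) r a :
  theory w r (Atom a) <-> theory w (prestr (atom_vars a) r) (Atom a).
Proof.
have [C [c [tc _ _]]] := theory_realizable w; rewrite tc /type_of pcomp_restr.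
by split=> -[ba sa]; split=> //; apply: sat_atom_ext sa => x xa; rewrite prestr_in.
Qed.

(** The invariant compares types only and is therefore symmetric, so a single [half] answers moves
    from both sides. One quantifier lowers the rank of agreement by one. *)
Lemma typed_bisim phi i A B (w : world (typed_frame A)) r
    (v : world (typed_frame B)) r2 :
  guarded g phi -> symbols_in S phi -> {subset all_vars phi <= V} ->
  rank phi <= i -> i <= k ->
  (forall s p, fragment i p -> theory w (prestr (free_vars phi) r \op s) p <->
                               theory v (prestr (free_vars phi) r2 \op s) p) ->
  fsat w r phi <-> fsat v r2 phi.
Proof.
have mono (D D' : seq nat) (T T' : (nat -> option nat) -> formula sigma -> Prop) (f f' : nat -> option nat) j :
    {subset D' <= D} ->
    (forall s p, fragment j p -> T (prestr D f \op s) p <-> T' (prestr D f' \op s) p) ->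
    forall s p, fragment j p -> T (prestr D' f \op s) p <-> T' (prestr D' f' \op s) p.
  move=> sD H s p fp; have e (f0 : nat -> option nat) :
      prestr D' f0 \op s = prestr D f0 \op (prestr D' Some \op s).
    by rewrite pcompA pcomp_restr pcompSome prestr_sub.
  by rewrite (e f) (e f'); apply: H.
have body (D D' : seq nat) (T T' : (nat -> option nat) -> formula sigma -> Prop) (f : nat -> option nat) j :
    {subset D' <= D} ->
    (forall s p, fragment j p -> T (prestr D f \op s) p <-> T' s p) ->
    forall s p, fragment j p -> T (prestr D' f \op s) p <-> T' (prestr D' Some \op s) p.
  move=> sD H s p fp.
  rewrite (_ : prestr D' f \op s = prestr D f \op (prestr D' Some \op s)) ?H //.
  by rewrite pcompA pcomp_restr pcompSome prestr_sub.
elim: phi i A B w r v r2 => [a|||p IH|p IHp q IHq|p IHp q IHq|xs G p IH|xs G p IH]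
  i A B w r v r2 //=.
- move=> _ aS aV _ _ wv; rewrite !typed_atom theory_restr (theory_restr v).
  exact: (wv Some).
- by move=> gp pS pV rk ik wv; rewrite (IH i A B w r v r2).
1,2: move=> /andP[gp gq] [pS qS] pqV; rewrite geq_max => /andP[rp rq] ik wv.
1,2: have pV : {subset all_vars p <= V} by move=> x xp; apply: pqV; rewrite mem_cat xp.
1,2: have qV : {subset all_vars q <= V} by
  move=> x xp; apply: pqV; rewrite mem_cat xp orbT.
1,2: rewrite (IHp i A B w r v r2) // ?(IHq i A B w r v r2) //.
1-4: by apply: mono wv => x xp; rewrite mem_cat xp ?orbT.
all: move=> /andP[gd gp] [GS pS] sV; case: i => // i rk ik wv.
all: have scV : {subset xs ++ guard_vars G ++ free_vars p <= V} by
  move=> x xs'; apply: sV; move: xs'; rewrite !mem_cat => /or3P[->|->|/free_vars_sub->];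
  rewrite ?orbT.
all: have pV : {subset all_vars p <= V} by
  move=> x xp; apply: sV; rewrite !mem_cat xp !orbT.
- have half A' B' (w1 : typed_tuple A') r1 (v1 : typed_tuple B') s1 :
      (forall s q, fragment i.+1 q ->
        theory w1 (prestr (free_vars (GEx xs G p)) r1 \op s) q <->
        theory v1 (prestr (free_vars (GEx xs G p)) s1 \op s) q) ->
      @fsat sigma (typed_frame A') w1 r1 (GEx xs G p) ->
      @fsat sigma (typed_frame B') v1 s1 (GEx xs G p).
    move=> wv1 [w' [r' [lk wG sp]]].
    have [|v' [lk' vG wv']] := typed_step ik gd scV GS wv1 lk.
      by move=> a /wG /typed_atom.
    exists v', Some; split=> //; first by move=> a /vG ?; apply/typed_atom.
    apply: (proj1 (IH i A' B' w' r' v' Some gp pS pV rk (ltnW ik) _) sp).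
    by apply: body wv'; apply: scope_body.
  by split; apply: half => // s q fq; rewrite wv.
- have half A' B' (w1 : typed_tuple A') r1 (v1 : typed_tuple B') s1 :
      (forall s q, fragment i.+1 q ->
        theory w1 (prestr (free_vars (GEx xs G p)) r1 \op s) q <->
        theory v1 (prestr (free_vars (GEx xs G p)) s1 \op s) q) ->
      @fsat sigma (typed_frame B') v1 s1 (GAll xs G p) ->
      @fsat sigma (typed_frame A') w1 r1 (GAll xs G p).
    move=> wv1 H w' r' lk wG.
    have [|v' [lk' vG wv']] := typed_step ik gd scV GS wv1 lk.
      by move=> a /wG /typed_atom.
    apply: (proj2 (IH i A' B' w' r' v' Some gp pS pV rk (ltnW ik) _)).
      by apply: body wv'; apply: scope_body.
    by apply: H => // a /vG ?; apply/typed_atom.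
  by split; apply: half => // s q fq; rewrite wv.
Qed.

End Types.

(** * Transfer *)

Lemma models_tree (sigma : vocabulary) (F : frame sigma) (w0 : world F) g phi :
  is_sentence phi -> guarded g phi -> models (tree w0) phi <-> fsat w0 Some phi.
Proof.
move=> /nilP s0 gp; apply: (@sat_tree _ _ w0 g phi [::]) => // x.
by rewrite s0.
Qed.

Section Transfer.
Variables (sigma : vocabulary) (g : guarding).
Variables (V : seq nat) (S : seq (symbol sigma)) (k : nat).
Hypothesis uV : uniq V.

Lemma type_realizable (B : structure sigma) (e : assignment B) :
  realizable g V S k e (type_of g V S k e).
Proof. by exists B, e; split=> // r p []. Qed.

Definition own_type (B : structure sigma) (e : assignment B) :
  typed_tuple g V S k B := TypedTuple (type_realizable e).

(** Each bag keeps its tuple and receives the type of that tuple in [A]; equal tuples have equal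
    types, which is all that a link asks. *)
Lemma tree_own_type (A : structure sigma) (e : assignment A) :
  exists h : tree (e : world (assignment_frame S A)) ->
             tree (own_type e : world (typed_frame g V S k A)), is_hom h.
Proof.
apply: (@tree_map _ (assignment_frame S A) (typed_frame g V S k A) (@own_type A)).
- by move=> w x y xy; split; first exact/basic_atom.
- by move=> w R zs [RS sR]; split; first exact/basic_atom.
- by move=> w r w' r' ww'; split=> // s p; rewrite /= /type_of !pcompA ww'.
Qed.

(** The facts of a bag belong to its type, hence hold of its tuple in [B]; linked bags carry the
    same elements, so the projections agree along edges. *)
Lemma tree_elements (B : structure sigma) (w : world (typed_frame g V S k B)) :
  exists h : tree w -> B, is_hom h.
Proof.
have sound (v : typed_tuple g V S k B) a : theory v Some (Atom a) ->
    sat_atom (elements v) a.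
  by have [C [c [_ _ vsat]]] := theory_realizable v => /vsat.
apply: (@tree_hom _ _ w B (fun t => elements (tip w t))).
- by move=> t x y vt /sound[b -> ->].
- by move=> t R zs vt /sound.
- move=> r r' u t x a b [[e _] _] rx rx' _.
  by have := congr1 (@^~ x) e; rewrite /pcomp rx rx'.
Qed.

Lemma transfer_sentence phi (A B : structure sigma) :
  is_sentence phi -> guarded g phi -> symbols_in S phi ->
  {subset all_vars phi <= V} -> rank phi <= k -> preserved_under_homs phi ->
  (forall p, fragment g V S k p -> is_sentence p -> models A p -> models B p) ->
  models A phi -> models B phi.
Proof.
move=> sphi gphi Sphi Vphi rphi pres AB Aphi.
pose eA : assignment A := fun=> None; pose eB : assignment B := fun=> None.
have none (T : Type) (r : nat -> option nat) : (fun=> None : option T) \op r = fun=> None.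
  by apply/funext => x; rewrite /pcomp; case: (r x).
(* The root of T'(B). A formula true under the empty assignment is a sentence, so A => B says
   precisely that the type of [A] is realised by the empty tuple of [B]. *)
have realB : realizable g V S k eB (type_of g V S k eA).
  exists A, eA; split=> // r p [bp]; rewrite /eA /eB !none => Ap.
  have p0 : is_sentence p.
    apply/nilP; case ep: (free_vars p) => [//|x s].
    have := pp_sat_def (basic_pp bp) Ap (x := x).
    by rewrite ep mem_head => /(_ isT).
  (* An atom without variables lies in the fragment, whatever [V] is. *)
  apply: AB => //; case: bp => // -[a ea aS].
  move: p0; rewrite ea /is_sentence /= => /nilP a0.
  by split=> //= x; rewrite a0.
pose wA : world (typed_frame g V S k A) := own_type eA.
pose wB : world (typed_frame g V S k B) := TypedTuple realB.
have [h hh] := tree_own_type eA; have [h' hh'] := tree_elements wB.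
(* The chain is traversed backwards from [B]; preservation is invoked at its two arrows. *)
apply: (pres _ _ _ hh'); apply/(models_tree _ sphi gphi).
apply/(typed_bisim uV (w := wA) (r := Some) (i := k)) => //.
apply/(models_tree _ sphi gphi); apply: (pres _ _ _ hh).
apply/(models_tree _ sphi gphi)/(fsat_assignment _ _ gphi Sphi).
by [].
Qed.

End Transfer.

Theorem theorem4p11 (g : guarding) (sigma : vocabulary) (n k : nat)
    (hn : 0 < n) (hk : 0 < k) (phi : formula sigma)
    (phi_sentence : is_sentence phi) (phi_guarded : guarded g phi)
    (phi_vars : num_vars phi <= n) (phi_rank : rank phi <= k) :
  preserved_under_homs phi <->
  exists psi : formula sigma,
    [/\ is_sentence psi, guarded g psi & existential_positive psi] /\
    [/\ num_vars psi <= n, rank psi <= k & logically_equivalent phi psi].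
Proof.
split=> [pres|[psi [[_ _ psi_ep] [_ _ eqv]]] A B h hh]; last first.
  by move=> /eqv/(sat_hom hh psi_ep) ?; apply/eqv.
have [S phi_S] := ex_symbols_in phi.
(* With only the variables of [phi] allowed, the bound n on their number is inherited. *)
pose V := undup (all_vars phi).
have phi_V : {subset all_vars phi <= V} by move=> x; rewrite mem_undup.
have [L LP] := finitely_many_fragment g V S k.
(* The disjuncts are the sentences of the finite list that entail [phi]; if there are none, the
   disjunction is [Bot]. *)
have [s [_ sP]] := sublistsP (fun p => [/\ fragment g V S k p, is_sentence p
  & forall A : structure sigma, models A p -> models A phi]) L.
exists (foldr (@Or sigma) Bot s).
have disj A : models A (foldr (@Or sigma) Bot s) <->
    exists2 p, List.In p s & models A p.
  rewrite /models; elim: (s) => /= [|p s' IH]; first by split=> // -[].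
  rewrite IH; split=> [[Ap|[q qs Aq]]|[q [->|qs] Aq]]; [exists p|exists q|left|right] => //.
  - by left.
  - by right.
  - by exists q.
have syn : [/\ is_sentence (foldr (@Or sigma) Bot s), guarded g (foldr (@Or sigma) Bot s),
    existential_positive (foldr (@Or sigma) Bot s), rank (foldr (@Or sigma) Bot s) <= k
    & {subset all_vars (foldr (@Or sigma) Bot s) <= V}].
  have : forall p, List.In p s -> fragment g V S k p /\ is_sentence p.
    by move=> p /sP[_ []].
  elim: (s) => //= p s' IH H; have [|i1 i2 i3 i4 i5] := IH.
    by move=> q qs; apply: H; right.
  have [[p1 p2 p3 p4 _] p0] := H p (or_introl erefl).
  split.
  - by move: p0 i1; rewrite /is_sentence /= => /nilP -> /nilP ->.
  - exact/andP.
  - by rewrite primitive_positive_existential.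
  - by rewrite geq_max p3.
  - by move=> x; rewrite mem_cat => /orP[/p4|/i5].
case: syn => s1 s2 s3 s4 s5; split=> //; split=> //.
  apply: leq_trans phi_vars; apply: uniq_leq_size; first exact: undup_uniq.
  by move=> x; rewrite mem_undup => /s5.
move=> B; rewrite disj; split=> [Bphi|[p /sP[_ [_ _ pphi]] /pphi//]].
(* [p] gathers all sentences of the fragment true in [B], so every model A of [p] satisfies B => A
   and inherits [phi] from [B]. Hence [p] entails [phi], and its representative [q] is one of the
   disjuncts. *)
have [p [fp vp pP]] := fragment_conj g V S k [::] (fun p => models B p).
have Bp : models B p by apply/pP.
have [q [qL fq vq qp]] := LP p fp.
have q0 : is_sentence q.
  by apply/nilP; case e: (free_vars q) => [//|x t]; have := vp x (vq x _); rewrite e mem_head => /(_ isT).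
exists q; last exact/qp.
apply/sP; split=> //; split=> // A /qp/pP AB.
apply: (transfer_sentence (undup_uniq _) phi_sentence phi_guarded phi_S phi_V
          phi_rank pres) Bphi.
move=> p' fp' /nilP p'0; apply: AB => // x; by rewrite p'0.
Qed.
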